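(* Let $n,k,\delta,g,r$ be integers with $r\ge 2$, $g\ge 0$ and $n\ge k+r(g+1)$. Let $\mathcal{G}_n^{k,\delta}$ be the set of simple connected graphs of order $n$ with minimum degree $\delta$ and $g$-good $r$-component connectivity $c\kappa_{g,r}(G)=k$, and let $G\in\mathcal{G}_n^{k,\delta}$. Let $\rho(\cdot)$ denote the adjacency spectral radius. Then the following statements hold. (I) If $k>\delta$ and $\delta<g$, then $\rho(G)\le\rho(G_{n,(g+1)^{r-1}}^{\delta,0})$, with equality if and only if $G\cong G_{n,(g+1)^{r-1}}^{\delta,0}$. (II) If $k>\delta\ge g$, then $\rho(G)\le\rho(G_{n,(g+1)^{r-1}}^{\delta-g,g})$, with equality if and only if $G\cong G_{n,(g+1)^{r-1}}^{\delta-g,g}$. (III) If $2\le k\le\delta<g$, then $\rho(G)\le\rho(G_{n,(g+1)^{r-1}}^{k-1,\delta-k+1})$, with equality if and only if $G\cong G_{n,(g+1)^{r-1}}^{k-1,\delta-k+1}$. (IV) If $1=k\le\delta<g$, then $\rho(G)\le\rho(G_{n,(g+1)^{r-1}}^{0,\delta})$, with equality if and only if $G\cong G_{n,(g+1)^{r-1}}^{0,\delta}$. (V) If $k\le\delta$ and $g\le\delta<g+k$, then $\rho(G)\le\rho(G_{n,(g+1)^{r-1}}^{\delta-g,g})$, with equality if and only if $G\cong G_{n,(g+1)^{r-1}}^{\delta-g,g}$. (VI) If $\delta\ge g+k$, then $\rho(G)\le\rho\big(K_k\vee(K_{n-k-(\delta-k+1)(r-1)}\cup(r-1)K_{\delta-k+1})\big)$,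 with equality if and only if $G\cong K_k\vee(K_{n-k-(\delta-k+1)(r-1)}\cup(r-1)K_{\delta-k+1})$.
   Context: All graphs are finite, simple and connected (except for intermediate graphs in constructions). The spectral radius $\rho(G)$ is the largest eigenvalue of the adjacency matrix $A(G)$. $K_m$ is the complete graph on $m$ vertices ($K_0$ is the empty graph), $G_1\cup G_2$ is the disjoint union, $mH$ is the disjoint union of $m$ copies of $H$, and the join $G_1\vee G_2$ is obtained from $G_1\cup G_2$ by adding all edges between a vertex of $G_1$ and a vertex of $G_2$. For $F\subseteq V(G)$, $F$ is a $g$-good $r$-component cut of $G$ if $G-F$ is disconnected with at least $r$ components and each vertex $v\in V(G)\setminus F$ has at least $g$ neighbors in $G-F$. The $g$-good $r$-component connectivity $c\kappa_{g,r}(G)$ is the minimum cardinality of a $g$-good $r$-component cut of $G$ (the statement $c\kappa_{g,r}(G)=k$ includes that such a cut exists). The graphs in the claim (each on $n$ vertices) are defined as follows; in each, edges added from the isolated vertex $K_1$ go to distinct vertices. - $G_{n,(g+1)^{r-1}}^{\delta,0}$: obtained from $K_1\cup\big(K_{k-1}\vee(K_{n-(r-1)(g+1)-k}\cup(r-1)K_{g+1})\big)$ by adding $\delta$ edges between the isolated vertex $K_1$ and $K_{k-1}$. - $G_{n,(g+1)^{r-1}}^{\delta-g,g}$: obtained from $K_1\cup\big(K_k\vee(K_{n-(r-1)(g+1)-k}\cup(r-2)K_{g+1}\cup K_g)\big)$ by adding $\delta-g$ edges between the isolated vertex $K_1$ and $K_k$, and adding $g$ edges between $K_1$ and $K_g$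 (so $K_1$ is joined to every vertex of $K_g$). - $G_{n,(g+1)^{r-1}}^{k-1,\delta-k+1}$: obtained from $K_1\cup\big(K_{k-1}\vee(K_{n-(r-1)(g+1)-k}\cup(r-1)K_{g+1})\big)$ by adding $k-1$ edges between the isolated vertex $K_1$ and $K_{k-1}$ (so $K_1$ is joined to every vertex of $K_{k-1}$), and adding $\delta-k+1$ edges between $K_1$ and $K_{n-(r-1)(g+1)-k}$. - $G_{n,(g+1)^{r-1}}^{0,\delta}$: obtained from $K_1\cup\big(K_{n-(r-1)(g+1)-1}\cup(r-1)K_{g+1}\big)$ by adding $\delta-r+1$ edges between the isolated vertex $K_1$ and $K_{n-(r-1)(g+1)-1}$, and adding one edge between $K_1$ and each of the $r-1$ copies of $K_{g+1}$. *)

(* Defs.v *)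
From HB Require Import structures.
From mathcomp Require Import all_boot all_order all_algebra.
From mathcomp Require Import boolp classical_sets reals complex.

Set Implicit Arguments.
Unset Strict Implicit.
Unset Printing Implicit Defensive.

Import Order.TTheory GRing.Theory Num.Theory.

Local Open Scope ring_scope.
Local Open Scope nat_scope.

Record sgraph := SGraph {
  vert :> finType;
  edge : rel vert;
  edge_sym : symmetric edge;
  edge_irr : irreflexive edge }.

Arguments edge {s}.

Definition deg (G : sgraph) (v : G) : nat := #|[set w | edge v w]|.

Definition connected_graph (G : sgraph) : Prop :=
  forall x y : G, connect edge x y.

Definition num_components (G : sgraph) : nat := n_comp (@edge G) predT.

Definition has_min_degree (G : sgraph) (d : nat) : Prop :=
  (exists v : G, deg v = d) /\ (forall v : G, d <= deg v).

Definition isomorphic (G H : sgraph) : Prop :=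
  exists2 f : G -> H, bijective f & forall x y, edge (f x) (f y) = edge x y.

Section Deletion.
Variables (G : sgraph) (F : {set G}).

Definition del_edge : rel {x : G | x \notin F} :=
  fun x y => edge (val x) (val y).

Lemma del_edge_sym : symmetric del_edge.
Proof. by move=> x y; apply: edge_sym. Qed.

Lemma del_edge_irr : irreflexive del_edge.
Proof. by move=> x; apply: edge_irr. Qed.

Definition del_vertices : sgraph := SGraph del_edge_sym del_edge_irr.

End Deletion.

Definition good_component_cut (g r : nat) (G : sgraph) (F : {set G}) : Prop :=
  [/\ ~ connected_graph (del_vertices F),
      r <= num_components (del_vertices F)
    & forall v : del_vertices F, g <= deg v].

Definition has_good_component_connectivity (g r : nat) (G : sgraph) (k : nat) :
    Prop :=
  (exists F : {set G}, good_component_cut g r F /\ #|F| = k) /\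
  (forall F : {set G}, good_component_cut g r F -> k <= #|F|).

Definition graph_family (n k delta g r : nat) (G : sgraph) : Prop :=
  [/\ connected_graph G, #|G| = n, has_min_degree G delta
    & has_good_component_connectivity g r G k].

Section SpectralRadius.
Local Open Scope ring_scope.

Definition adjacency (R : realType) (G : sgraph) : 'M[R]_#|G| :=
  \matrix_(i, j) (edge (enum_val i) (enum_val j))%:R.

(* The supremum is a maximum as soon as G has a vertex, since the adjacency
   matrix is symmetric; see spectral_radius_max. *)
Definition spectral_radius (R : realType) (G : sgraph) : R :=
  sup [set x : R | eigenvalue (adjacency R G) x]%classic.

Local Open Scope sesquilinear_scope.

Lemma spectral_radius_max (R : realType) (G : sgraph) : (0 < #|G|)%N ->
  eigenvalue (adjacency R G) (spectral_radius R G) /\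
  forall x, eigenvalue (adjacency R G) x -> x <= spectral_radius R G.
Proof.
set A := adjacency R G; move=> G_gt0.
pose toC := real_complex R; pose B := map_mx toC A.
have symB : B \is hermsymmx.
  apply: realsym_hermsym; last first.
    by apply/mxOverP => i j; rewrite !mxE; apply/complex_realP; eexists.
  apply/is_hermitianmxP; rewrite expr0 scale1r map_mx_id ?/= //.
  by apply/matrixP => i j; rewrite !mxE edge_sym.
have /orthomx_spectralP defB := hermitian_normalmx symB.
have Dreal := hermitian_spectral_diag_real symB.
move: defB Dreal; set P := spectralmx B; set D := spectral_diag B => defB Dreal.
have uP : P \in unitmx by apply: spectral_unit.
have PB : P *m B = diag_mx D *m P by rewrite {1}defB !mulmxA mulmxV // mul1mx.
pose d i := complex.Re (D 0 i).
have dE i : (d i)%:C%C = D 0 i by apply: RRe_real; exact: (mxOverP Dreal).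
have toCE x : eigenvalue A x = eigenvalue B (toC x).
  by rewrite !eigenvalue_root_char -map_char_poly fmorph_root.
have d_eig i : eigenvalue A (d i).
  rewrite toCE /toC dE; apply/eigenvalueP; exists (row i P).
    by rewrite -row_mul PB row_mul row_diag_mx -scalemxAl -rowE.
  apply/negP => /eqP rP0; have : row i P *m invmx P = 0 by rewrite rP0 mul0mx.
  rewrite -row_mul mulmxV // => /rowP /(_ i); rewrite !mxE eqxx => /eqP.
  by rewrite oner_eq0.
have eig_d x : eigenvalue A x -> exists i, x = d i.
  rewrite toCE => /eigenvalueP[v vB v0].
  have [j uj] : exists j, (v *m invmx P) 0 j != 0.
    apply/rV0Pn; apply: contraNneq v0 => u0.
    by rewrite -(mulmxKV uP v) u0 mul0mx.
  exists j; apply: (@complexI R); rewrite dE.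
  have : (v *m invmx P) *m diag_mx D = toC x *: (v *m invmx P).
    by rewrite scalemxAl -vB {1}defB !mulmxA mulmxK.
  move=> /rowP /(_ j); rewrite mul_mx_diag !mxE mulrC.
  by move: uj; rewrite !mxE => uj /(mulIf uj).
have [i0 _ d_max] := @Order.TotalTheory.arg_maxP _ R _ (Ordinal G_gt0) xpredT d erefl.
have max x : eigenvalue A x -> x <= d i0.
  by move=> /eig_d[i ->]; exact: d_max.
suff -> : spectral_radius R G = d i0 by [].
apply/le_anti/andP; split.
  by apply: ge_sup => //; exists (d i0); exact: d_eig.
apply: ub_le_sup; last exact: d_eig.
by exists (d i0).
Qed.

End SpectralRadius.

Section Complete.
Variable m : nat.

Definition complete_edge : rel 'I_m := fun i j => i != j.

Lemma complete_edge_sym : symmetric complete_edge.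
Proof. by move=> i j; rewrite /complete_edge eq_sym. Qed.

Lemma complete_edge_irr : irreflexive complete_edge.
Proof. by move=> i; rewrite /complete_edge eqxx. Qed.

Definition complete : sgraph := SGraph complete_edge_sym complete_edge_irr.

End Complete.

Section UnionJoin.
Variables G H : sgraph.

(* b = false gives the disjoint union, b = true the join. *)
Definition sum_edge (b : bool) : rel (G + H)%type := fun x y =>
  match x, y with
  | inl u, inl v => edge u v
  | inr u, inr v => edge u v
  | _, _ => b
  end.

Lemma sum_edge_sym b : symmetric (sum_edge b).
Proof. by move=> [x|x] [y|y] //=; apply: edge_sym. Qed.

Lemma sum_edge_irr b : irreflexive (sum_edge b).
Proof. by move=> [x|x] /=; apply: edge_irr. Qed.

Definition gunion : sgraph := SGraph (sum_edge_sym false) (sum_edge_irr false).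
Definition gjoin : sgraph := SGraph (sum_edge_sym true) (sum_edge_irr true).

End UnionJoin.

Section Copies.
Variables (m : nat) (H : sgraph).

Definition copies_edge : rel ('I_m * H)%type :=
  fun x y => (x.1 == y.1) && edge x.2 y.2.

Lemma copies_edge_sym : symmetric copies_edge.
Proof. by move=> x y; rewrite /copies_edge eq_sym edge_sym. Qed.

Lemma copies_edge_irr : irreflexive copies_edge.
Proof. by move=> x; rewrite /copies_edge edge_irr andbF. Qed.

Definition copies : sgraph := SGraph copies_edge_sym copies_edge_irr.

End Copies.

Section AddEdges.
Variables (G : sgraph) (e : rel G).

Definition add_edge : rel G :=
  fun x y => edge x y || (x != y) && (e x y || e y x).

Lemma add_edge_sym : symmetric add_edge.
Proof. by move=> x y; rewrite /add_edge edge_sym eq_sym orbC [e x y || _]orbC orbC. Qed.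

Lemma add_edge_irr : irreflexive add_edge.
Proof. by move=> x; rewrite /add_edge edge_irr eqxx. Qed.

Definition add_edges : sgraph := SGraph add_edge_sym add_edge_irr.

End AddEdges.

(* K_1 \cup H with the isolated vertex joined to the vertices in N *)
Definition attach (H : sgraph) (N : pred H) : sgraph :=
  @add_edges (gunion (complete 1) H) (fun x y =>
    match x, y with
    | inl _, inr v => N v
    | _, _ => false
    end).

Notation "G :|_|: H" := (gunion G H) (at level 52, left associativity).
Notation "G :\/: H" := (gjoin G H) (at level 51, left associativity).
Notation "m :*: H" := (copies m H) (at level 50, no associativity).
Notation "''K_' m" := (complete m) (at level 8, m at level 2, format "''K_' m").

(* Up to isomorphism the graphs below depend only on how many vertices of each
   clique are joined to K_1; the first ones are used.  The subtractions are
   truncated, but are genuine integer subtractions whenever the family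
   graph_family is nonempty and the corresponding case of the theorem applies. *)

Definition G_delta_0 (n k delta g r : nat) : sgraph :=
  @attach ('K_(k - 1) :\/:
             ('K_(n - (r - 1) * (g + 1) - k) :|_|: (r - 1) :*: 'K_(g + 1)))
    (fun x => match x with
       | inl i => i < delta
       | inr _ => false
       end).

Definition G_deltag_g (n k delta g r : nat) : sgraph :=
  @attach ('K_k :\/:
             ('K_(n - (r - 1) * (g + 1) - k) :|_|: (r - 2) :*: 'K_(g + 1)
                :|_|: 'K_g))
    (fun x => match x with
       | inl i => i < delta - g
       | inr (inl _) => false
       | inr (inr _) => true
       end).

Definition G_k1_deltak1 (n k delta g r : nat) : sgraph :=
  @attach ('K_(k - 1) :\/:
             ('K_(n - (r - 1) * (g + 1) - k) :|_|: (r - 1) :*: 'K_(g + 1)))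
    (fun x => match x with
       | inl _ => true
       | inr (inl i) => i < delta + 1 - k
       | inr (inr _) => false
       end).

Definition G_0_delta (n delta g r : nat) : sgraph :=
  @attach ('K_(n - (r - 1) * (g + 1) - 1) :|_|: (r - 1) :*: 'K_(g + 1))
    (fun x => match x with
       | inl i => i < delta + 1 - r
       | inr (_, j) => j == 0 :> nat
       end).

Definition G_join (n k delta r : nat) : sgraph :=
  'K_k :\/: ('K_(n - k - (delta + 1 - k) * (r - 1))
               :|_|: (r - 1) :*: 'K_(delta + 1 - k)).

Definition spectral_bound (R : realType) (G H : sgraph) : Prop :=
  (spectral_radius R G <= spectral_radius R H)%R /\
  (spectral_radius R G = spectral_radius R H <-> isomorphic G H).

(* Main.v *)
Require Import Defs.
From mathcomp Require Import all_boot all_order all_algebra all_fingroup reals.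
From mathcomp Require Import boolp complex.
From mathcomp Require Import ring lra zify.

(* Let [F] be a cut of size [k] and [v] a vertex of degree [delta].  Grouping
   the components of [G - F] into [r] classes, [G] is a spanning subgraph of
   [rewired c v W]: the join of the clique on [F] with [r] disjoint cliques, in
   which the neighbourhood of [v] is replaced by [W].  Among all such
   configurations choose one of maximal spectral radius, with Perron vector [x].
   Up to a constant, the quadratic form of the adjacency matrix at [x] is the
   quantity [energy x c v W], which depends only on the weights of the classes,
   of [W] and of the neighbourhood that [W] replaces.  By Rayleigh's principle no
   other configuration has a larger energy at [x], nor at [x] composed with a
   transposition.  Moving a vertex to a heavier class, redirecting an edge of
   [v], or exchanging [v] with a vertex of another class would increase it,
   unless the configuration is the extremal graph.  When [g + k <= delta] the
   minimum degree already bounds the sizes of the classes from below, and no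
   vertex needs to be rewired. *)

Set Implicit Arguments.
Unset Strict Implicit.
Unset Printing Implicit Defensive.

Import Order.TTheory GRing.Theory Num.Theory.

(** * Rayleigh quotients and Perron vectors *)

(** In a join of a [k]-clique with cliques of at least [g + 1] vertices every vertex outside the cut
    already has degree at least [g + k]. This is the origin of the threshold: for [delta < g + k]
    such a join overshoots the minimum degree, and one vertex has to be thinned out to degree
    [delta]; for larger [delta] only the sizes of the cliques matter. Enlarging the set of
    competitors is harmless because its maximisers turn out to be the extremal graph itself. The
    obstacle is that nothing is known beforehand about the order of the Perron entries of two
    exchanged vertices. Evaluating the competitor at [x] composed with their transposition treats
    the opposite order: the competitor is then compared through an isomorphic copy. When an energy
    stays constant, the equality case of Rayleigh's principle makes the test vector an eigenvector
    of the new graph, and this gives strictness. For [delta >= g] the hard point is to exclude that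
    the thinned vertex lies in the cut; there the sizes of the Perron entries must be estimated from
    the eigenvalue equations. *)

Section Spectral.
Variable R : realType.
Local Open Scope ring_scope.
Implicit Types (G H : sgraph).

Lemma mul_adjacencyE G (u : 'rV[R]_#|G|) x :
  (u *m adjacency R G) 0 (enum_rank x)
  = \sum_(y : G | edge x y) u 0 (enum_rank y).
Proof.
rewrite mxE [RHS]big_mkcond [RHS](reindex_onto enum_val enum_rank) /=; last first.
  by move=> y _; rewrite enum_rankK.
apply: eq_big => [i|i _]; first by rewrite enum_valK eqxx.
by rewrite !mxE enum_rankK enum_valK edge_sym; case: ifP; rewrite ?mulr1 ?mulr0.
Qed.

Lemma eigenvalue_adjacencyP G (a : R) :
  eigenvalue (adjacency R G) a <->
  exists2 f : G -> R, (exists x, f x != 0) &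
    forall x, \sum_(y : G | edge x y) f y = a * f x.
Proof.
split=> [/eigenvalueP[u uA /rV0Pn[i ui]]|[f [x fx] fA]].
  exists (fun x => u 0 (enum_rank x)); first by exists (enum_val i); rewrite enum_valK.
  by move=> x; rewrite -mul_adjacencyE uA mxE.
apply/eigenvalueP; exists (\row_i f (enum_val i)).
  apply/rowP => i; rewrite -{1}(enum_valK i) mul_adjacencyE !mxE -fA.
  by apply: eq_bigr => y _; rewrite mxE enum_rankK.
by apply/rV0Pn; exists (enum_rank x); rewrite mxE enum_rankK.
Qed.

Definition quad G (f : G -> R) : R := \sum_x \sum_(y : G | edge x y) f x * f y.

Local Open Scope sesquilinear_scope.

(** The symmetric matrix is diagonalised by a unitary matrix over the complex numbers. In the
    coordinates [y] of [f] the difference of the two sides is the sum of the nonnegative terms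
    [(rho - d i) * |y i| ^ 2]. When it vanishes, [y] is supported on the eigenspace of [rho]. *)
Lemma rayleigh G (f : G -> R) : (0 < #|G|)%N ->
  quad f <= spectral_radius R G * \sum_x f x ^+ 2 /\
  (quad f = spectral_radius R G * \sum_x f x ^+ 2 ->
   forall x, \sum_(y : G | edge x y) f y = spectral_radius R G * f x).
Proof.
move=> G_gt0; have [_ rho_max] := spectral_radius_max R G_gt0.
set rho := spectral_radius R G in rho_max *.
set A := adjacency R G in rho_max *.
pose toC : {rmorphism R -> complex R} := real_complex R; pose B := map_mx toC A.
have symB : B \is hermsymmx.
  apply: realsym_hermsym; last first.
    by apply/mxOverP => i j; rewrite !mxE; apply/complex_realP; eexists.
  apply/is_hermitianmxP; rewrite expr0 scale1r map_mx_id ?/= //.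
  by apply/matrixP => i j; rewrite !mxE edge_sym.
have /orthomx_spectralP defB := hermitian_normalmx symB.
have Dreal := hermitian_spectral_diag_real symB.
move: defB Dreal; have := spectral_unitarymx B.
set P := spectralmx B; set D := spectral_diag B => Punit defB Dreal.
have uP : P \in unitmx by apply: spectral_unit.
have PVE : invmx P = P ^t* by rewrite (invmx_unitary Punit).
pose d i := complex.Re (D 0 i).
have dE i : toC (d i) = D 0 i by apply: RRe_real; exact: (mxOverP Dreal).
have toCE x : eigenvalue A x = eigenvalue B (toC x).
  by rewrite !eigenvalue_root_char -map_char_poly fmorph_root.
have d_le i : d i <= rho.
  apply: rho_max; rewrite toCE dE; apply/eigenvalueP; exists (row i P).
    have PB : P *m B = diag_mx D *m P by rewrite {1}defB !mulmxA mulmxV // mul1mx.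
    by rewrite -row_mul PB row_mul row_diag_mx -scalemxAl -rowE.
  apply/negP => /eqP rP0; have : row i P *m invmx P = 0 by rewrite rP0 mul0mx.
  rewrite -row_mul mulmxV // => /rowP /(_ i); rewrite !mxE eqxx => /eqP.
  by rewrite oner_eq0.
pose u : 'rV[R]_#|G| := \row_i f (enum_val i).
pose z := map_mx toC u; pose y := z *m P ^t*.
have zE : z = y *m P by rewrite /y -PVE mulmxKV.
have zB : z *m B = y *m diag_mx D *m P by rewrite defB PVE /y !mulmxA.
have ysE : y ^t* = P *m z^T.
  rewrite /y trmx_mul map_mxM trmxCK; congr (_ *m _).
  by apply: realmxC; apply/mxOverP => i j; rewrite !mxE; apply/complex_realP; eexists.
have normy : \sum_i `|y 0 i| ^+ 2 = toC (\sum_x f x ^+ 2).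
  transitivity ((y *m y ^t*) 0 0).
    by rewrite mxE; apply: eq_bigr => i _; rewrite !mxE normCK.
  rewrite ysE mulmxA -zE mxE rmorph_sum /= [RHS](reindex_onto enum_val enum_rank) /=; last first.
    by move=> x _; rewrite enum_rankK.
  apply: eq_big => [i|i _]; first by rewrite enum_valK eqxx.
  by rewrite !mxE -rmorphM -expr2.
have quady : \sum_i D 0 i * `|y 0 i| ^+ 2 = toC (quad f).
  transitivity ((y *m diag_mx D *m y ^t*) 0 0).
    rewrite mxE; apply: eq_bigr => i _; rewrite mul_mx_diag !mxE normCK.
    by rewrite mulrA [D 0 i * _]mulrC.
  rewrite ysE mulmxA -zB (_ : z^T = map_mx toC u^T); last by apply/matrixP => i j; rewrite !mxE.
  rewrite -!map_mxM mxE; congr (toC _).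
  rewrite mxE [RHS](reindex_onto enum_val enum_rank) /=; last first.
    by move=> x _; rewrite enum_rankK.
  apply: eq_big => [i|i _]; first by rewrite enum_valK eqxx.
  rewrite -{1}(enum_valK i) mul_adjacencyE !mxE mulrC mulr_sumr.
  by apply: eq_bigr => x _; rewrite mxE enum_rankK.
have gap : \sum_i toC (rho - d i) * `|y 0 i| ^+ 2
         = toC (rho * (\sum_x f x ^+ 2) - quad f).
  rewrite rmorphB rmorphM /= -normy -quady mulr_sumr -sumrB.
  by apply: eq_bigr => i _; rewrite rmorphB mulrBl dE.
have gap_ge0 i : 0 <= toC (rho - d i) * `|y 0 i| ^+ 2.
  apply: mulr_ge0; last exact: exprn_ge0.
  by rewrite -(rmorph0 toC) lecR subr_ge0.
split.
  have : 0 <= toC (rho * (\sum_x f x ^+ 2) - quad f) by rewrite -gap sumr_ge0.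
  by rewrite -(rmorph0 toC) lecR subr_ge0.
move=> eq_quad.
have yD : y *m diag_mx D = toC rho *: y.
  apply/rowP => i; rewrite mul_mx_diag !mxE mulrC.
  have /eqP := gap; rewrite eq_quad subrr rmorph0 psumr_eq0 // => /allP /(_ i).
  rewrite mem_index_enum => /(_ isT); rewrite mulf_eq0 expf_eq0 normr_eq0 /=.
  rewrite rmorphB dE subr_eq0 => /orP[/eqP <- //|/eqP].
  by rewrite mxE => ->; rewrite !mulr0.
have uA : u *m A = rho *: u.
  apply: (map_mx_inj (f := toC)); rewrite map_mxM map_mxZ -/z -/B zB yD.
  by rewrite -scalemxAl -zE.
move=> x; have := congr1 (fun M : 'rV_#|G| => M 0 (enum_rank x)) uA.
rewrite mul_adjacencyE !mxE enum_rankK => <-.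
by apply: eq_bigr => w _; rewrite mxE enum_rankK.
Qed.

Lemma test_vector G (f : G -> R) (a : R) : (exists x, f x != 0) ->
    a * (\sum_x f x ^+ 2) <= quad f ->
  a <= spectral_radius R G /\
  (spectral_radius R G = a -> forall x, \sum_(y : G | edge x y) f y = a * f x).
Proof.
move=> [x0 fx0] le_quad; have G_gt0 : (0 < #|G|)%N by apply/card_gt0P; exists x0.
have [le_rho eq_rho] := rayleigh f G_gt0.
have f2_gt0 : 0 < \sum_x f x ^+ 2.
  rewrite (bigD1 x0) //= ltr_wpDr ?sumr_ge0 // => [x _|]; first exact: sqr_ge0.
  by rewrite lt0r sqrf_eq0 fx0 sqr_ge0.
split=> [|rhoE x]; first by rewrite -(ler_pM2r f2_gt0) (le_trans le_quad).
by rewrite -rhoE; apply: eq_rho; apply/le_anti; rewrite le_rho rhoE.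
Qed.

(** The absolute value of an eigenvector for the spectral radius has the same norm and at least the
    same quadratic form, hence is an eigenvector too. A zero of it would spread along the edges to
    the whole connected graph. *)
Lemma perron_vector G : (0 < #|G|)%N -> connected_graph G ->
  exists2 f : G -> R, (forall x, 0 < f x) &
    forall x, \sum_(y : G | edge x y) f y = spectral_radius R G * f x.
Proof.
move=> G_gt0 conG; have [rho_eig _] := spectral_radius_max R G_gt0.
have /eigenvalue_adjacencyP[f [x0 fx0] fE] := rho_eig.
pose h x := `|f x|.
have hE : forall x, \sum_(y : G | edge x y) h y = spectral_radius R G * h x.
  have [||_] := @test_vector G h (spectral_radius R G).
  - by exists x0; rewrite /h normr_eq0.
  - have -> : \sum_x h x ^+ 2 = \sum_x f x ^+ 2.
      by apply: eq_bigr => x _; rewrite /h -normrX ger0_norm ?sqr_ge0.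
    have -> : spectral_radius R G * (\sum_x f x ^+ 2) = quad f.
      rewrite mulr_sumr; apply: eq_bigr => x _.
      by rewrite -mulr_sumr fE expr2 mulrCA.
    apply: ler_sum => x _; apply: ler_sum => y _.
    by rewrite /h -normrM ler_norm.
  - exact.
have h_ge0 x : 0 <= h x by exact: normr_ge0.
have h0_edge x y : edge x y -> h x = 0 -> h y = 0.
  move=> xy hx0; have /eqP := hE x; rewrite hx0 mulr0 psumr_eq0 //.
  by move=> /allP /(_ y); rewrite mem_index_enum xy => /(_ isT) /eqP.
exists h => // x; rewrite lt0r h_ge0 andbT; apply: contra_neq fx0 => hx0.
suff /eqP : h x0 == 0 by rewrite /h => /normr0_eq0.
have /connectP[p] := conG x x0; elim: p x hx0 => [|y p IHp] x hx0 /=.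
  by move=> _ ->; apply/eqP.
by move=> /andP[xy yp] last_p; apply: (IHp y) => //; exact: h0_edge xy hx0.
Qed.

Lemma isomorphic_sym G H : isomorphic G H -> isomorphic H G.
Proof.
move=> [f [f' fK f'K] fE]; exists f'; first by exists f.
by move=> x y; rewrite -fE !f'K.
Qed.

Lemma isomorphic_trans G H K : isomorphic G H -> isomorphic H K -> isomorphic G K.
Proof.
move=> [f bij_f fE] [h bij_h hE]; exists (h \o f); first exact: bij_comp.
by move=> x y; rewrite /= hE fE.
Qed.

Lemma isomorphic_spectral_radius G H :
  isomorphic G H -> spectral_radius R G = spectral_radius R H.
Proof.
suff sub G1 G2 (a : R) : isomorphic G1 G2 ->
    eigenvalue (adjacency R G1) a -> eigenvalue (adjacency R G2) a.
  move=> isoGH; congr (sup _); apply/classical_sets.seteqP; split=> a; apply: sub => //.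
  exact: isomorphic_sym.
move=> /isomorphic_sym[h [h' hK h'K] hE] /eigenvalue_adjacencyP[f [x fx] fE].
apply/eigenvalue_adjacencyP; exists (f \o h); first by exists (h' x); rewrite /= h'K.
move=> y; rewrite /= -fE [RHS](reindex h) /=; last by exists h' => z _.
by apply: eq_bigl => z; rewrite hE.
Qed.

Lemma spectral_radius_subgraph G H (f : G -> H) : (0 < #|G|)%N ->
    connected_graph G -> bijective f ->
    (forall x y, edge x y -> edge (f x) (f y)) ->
  spectral_radius R G <= spectral_radius R H /\
  (spectral_radius R G = spectral_radius R H -> isomorphic G H).
Proof.
move=> G_gt0 conG bij_f sub; have [x x_gt0 xE] := perron_vector G_gt0 conG.
have [f' fK f'K] := bij_f.
have sumE (P : pred H) (F : G -> R) :
    \sum_(y | P y) F (f' y) = \sum_(z | P (f z)) F z.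
  rewrite (reindex f) /=; last by exists f' => z _.
  by apply: eq_bigr => z _; rewrite fK.
have [||le_rho eq_rho] := @test_vector H (x \o f') (spectral_radius R G).
- have /card_gt0P[z _] := G_gt0; exists (f z).
  by rewrite /= fK gt_eqF.
- rewrite (sumE predT (fun z => x z ^+ 2)) /quad.
  rewrite (eq_bigr (fun a => \sum_(z | edge a (f z)) x (f' a) * x z)); last first.
    by move=> a _; rewrite -(sumE _ (fun z => x (f' a) * x z)).
  rewrite (reindex f) /=; last by exists f' => z _.
  rewrite mulr_sumr; apply: ler_sum => a _; rewrite fK expr2 mulrCA -xE mulr_sumr.
  rewrite [leLHS]big_mkcond [leRHS]big_mkcond /=; apply: ler_sum => b _.
  case: ifP => [/sub -> //|_]; case: ifP => // _.
  by rewrite mulr_ge0 // ltW.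
split=> // rhoE; exists f => // a b; apply/idP/idP; last exact: sub.
(* An edge of [H] absent from [G] would make the neighbour sum at [f a] strictly larger than the one
   at [a], although equal spectral radii force both to satisfy the same eigenvalue equation. *)
move=> fab; apply: contraT => nab.
have := eq_rho (esym rhoE) (f a); rewrite sumE /= fK -xE => /eqP; rewrite eq_sym.
apply: contraTT => _; rewrite lt_eqF //.
rewrite [ltRHS](bigID (edge a)) /= [X in _ < X + _](eq_bigl (edge a)); last first.
  by move=> z; case: (boolP (edge a z)) => [/sub ->|_]; rewrite ?andbF.
rewrite ltrDl (bigD1 b) /= ?fab ?nab // ltr_wpDr //; apply: sumr_ge0 => z _.
exact: ltW.
Qed.
End Spectral.

(** * Joins of cliques with one rewired vertex *)

Section CliqueJoin.
Variables (V : finType) (r : nat).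
Implicit Types (c : V -> option 'I_r) (v : V) (W : {set V}).

Definition cj_edge c : rel V :=
  fun a b => (a != b) && [|| c a == None, c b == None | c a == c b].

Lemma cj_edge_sym c : symmetric (cj_edge c).
Proof.
by move=> a b; rewrite /cj_edge eq_sym (eq_sym (c a) (c b)) orbCA.
Qed.

Lemma cj_edge_irr c : irreflexive (cj_edge c).
Proof. by move=> a; rewrite /cj_edge eqxx. Qed.

(* [c a = None] encodes a vertex of the joined clique, [c a = Some i] a vertex
   of the [i]-th clique of the disjoint union. *)
Definition clique_join c : sgraph := SGraph (@cj_edge_sym c) (@cj_edge_irr c).

Definition rw_edge c v W : rel V := fun a b =>
  (a != b) && (if a == v then b \in W else if b == v then a \in W else cj_edge c a b).

Lemma rw_edge_sym c v W : symmetric (rw_edge c v W).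
Proof.
move=> a b; rewrite /rw_edge eq_sym cj_edge_sym.
by case: (eqVneq a v) => [->|]; case: (eqVneq b v) => [->|].
Qed.

Lemma rw_edge_irr c v W : irreflexive (rw_edge c v W).
Proof. by move=> a; rewrite /rw_edge eqxx. Qed.

Definition rewired c v W : sgraph :=
  SGraph (@rw_edge_sym c v W) (@rw_edge_irr c v W).

Lemma rw_edge_other c v W a b : a != v -> b != v ->
  rw_edge c v W a b = cj_edge c a b.
Proof.
by move=> av bv; rewrite /rw_edge (negbTE av) (negbTE bv) /cj_edge; case: eqVneq.
Qed.

Lemma rw_edgeL c v W b : v \notin W -> rw_edge c v W v b = (b \in W).
Proof. by move=> vW; rewrite /rw_edge eqxx; case: eqVneq => // <-; rewrite (negbTE vW). Qed.

Section Quad.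
Variable R : realType.
Local Open Scope ring_scope.
Implicit Types x : V -> R.

Definition cweight x c i : R := \sum_(a | c a == Some i) x a.

(** Minus twice the sum of the products of the weights of distinct classes: the contribution of the
    missing edges to the quadratic form. *)
Definition spread x c : R :=
  \sum_i cweight x c i ^+ 2 - (\sum_i cweight x c i) ^+ 2.

(** The weight of the neighbourhood of [v] before rewiring, as [nweightE] shows; the first
    difference is the weight of the cut. *)
Definition nweight x c v : R :=
  if c v is Some i then
    \sum_a x a - \sum_i cweight x c i + cweight x c i - x v
  else \sum_a x a - x v.

Definition energy x c v W : R :=
  spread x c + 2 * x v * (\sum_(a in W) x a - nweight x c v).

Lemma sum_cweight x c : \sum_i cweight x c i = \sum_(a | c a != None) x a.
Proof.
rewrite /cweight (exchange_big_dep (fun a => c a != None)) /=; last first.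
  by move=> i a _ /eqP ->.
apply: eq_bigr => a; case: (c a) => // i _.
by rewrite (eq_bigl (pred1 i)) ?big_pred1_eq // => j; rewrite /= eq_sym.
Qed.

Lemma nweightE x c v : \sum_(b | cj_edge c v b) x b = nweight x c v.
Proof.
rewrite /nweight; case cv: (c v) => [i|]; last first.
  rewrite [X in _ = X - _](bigD1 v) //= addrAC subrr add0r.
  by apply: eq_bigl => b; rewrite /cj_edge cv eqxx andbT eq_sym.
rewrite sum_cweight [X in _ = X - _ + _ - _](bigID (fun a => c a != None)) /= (addrAC (\sum_(a | c a != None) _)) subrr add0r.
rewrite /cweight [X in _ + X - _](bigD1 v) ?cv //= addrA (addrAC _ (x v)) addrK.
rewrite (bigID (fun a => c a == None)) /=; congr (_ + _); apply: eq_bigl => b.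
  rewrite negbK /cj_edge cv andbC; case: (eqVneq (c b) None) => //= cb.
  by rewrite andbT; apply: contra_eqN cv => /eqP ->; rewrite cb.
rewrite /cj_edge cv /= (eq_sym v b) (eq_sym (Some i)).
by case: (c b) => [j|]; rewrite /= ?andbF //= andbT andbC.
Qed.

Lemma quad_clique_join x c :
  quad (G := clique_join c) x = (\sum_a x a) ^+ 2 - \sum_a x a ^+ 2 + spread x c.
Proof.
rewrite /quad (eq_bigr (fun a => x a * nweight x c a)); last first.
  by move=> a _; rewrite -nweightE mulr_sumr.
rewrite (bigID (fun a => c a != None)) /=.
have sE (F : 'I_r -> V -> R) :
    \sum_(a | c a != None) (if c a is Some i then F i a else 0) =
    \sum_i \sum_(a | c a == Some i) F i a.
  rewrite [RHS](exchange_big_dep (fun a => c a != None)) /=; last first.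
    by move=> i a _ /eqP ->.
  apply: eq_bigr => a; case: (c a) => // i _.
  by rewrite (eq_bigl (pred1 i)) ?big_pred1_eq // => j; rewrite /= eq_sym.
set X := \sum_a x a; set s := \sum_i cweight x c i.
have -> : \sum_(a | c a != None) x a * nweight x c a =
    \sum_i cweight x c i ^+ 2 + (X - s) * s - \sum_(a | c a != None) x a ^+ 2.
  transitivity (\sum_(a | c a != None) ((if c a is Some i then x a * cweight x c i else 0)
     + ((X - s) * x a - x a ^+ 2))).
    apply: eq_bigr => a; rewrite /nweight; case: (c a) => // i _.
    by rewrite -/s -/X; ring.
  rewrite big_split /= sE sumrB -mulr_sumr -sum_cweight -/s addrA; congr (_ + _ - _).
  by apply: eq_bigr => i _; rewrite -mulr_suml -expr2.
have -> : \sum_(a | ~~ (c a != None)) x a * nweight x c a =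
    (X - s) * X - \sum_(a | ~~ (c a != None)) x a ^+ 2.
  have -> : X - s = \sum_(a | ~~ (c a != None)) x a.
    by rewrite /s sum_cweight /X (bigID (fun a => c a != None)) /= addrAC subrr add0r.
  rewrite mulr_suml -sumrB; apply: eq_bigr => a; rewrite /nweight.
  by case: (c a) => // _; rewrite mulrBr expr2.
rewrite [\sum_a x a ^+ 2](bigID (fun a => c a != None)) /= /spread -/s.
by ring.
Qed.

Lemma quadD1 (e : rel V) (se : symmetric e) (ie : irreflexive e) x v :
  quad (G := SGraph se ie) x = 2 * x v * (\sum_(b | e v b) x b) +
    \sum_(a | a != v) \sum_(b | (b != v) && e a b) x a * x b.
Proof.
rewrite /quad (bigD1 v) //= -mulr_sumr.
have -> : \sum_(a | a != v) \sum_(b | e a b) x a * x b =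
   \sum_(a | a != v) ((if e v a then x v * x a else 0) +
   \sum_(b | (b != v) && e a b) x a * x b).
  apply: eq_bigr.
  move=> a av; rewrite (bigID (pred1 v)) /=; congr (_ + _); last first.
    by apply: eq_bigl => b; rewrite andbC.
  case: ifP => va.
    by rewrite (big_pred1 v) ?[x v * _]mulrC // => b; rewrite /= andbC; case: eqVneq => //= ->; rewrite se.
  rewrite big_pred0 // => b; case: eqVneq => [->|]; rewrite ?andbF //.
  by rewrite se va.
rewrite big_split /= addrA; congr (_ + _).
rewrite -big_mkcondr -mulr_sumr (eq_bigl (e v)); last first.
  by move=> b; case: eqVneq => //= ->; rewrite ie.
by rewrite -mulrA mulr2n mulrDl mul1r.
Qed.

Lemma quad_rewired x c v W : v \notin W ->
  quad (G := rewired c v W) x = (\sum_a x a) ^+ 2 - \sum_a x a ^+ 2 + energy x c v W.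
Proof.
move=> vW; rewrite /energy addrA -quad_clique_join !(quadD1 _ _ x v) nweightE.
have -> : \sum_(b | rw_edge c v W v b) x b = \sum_(b in W) x b.
  by apply: eq_bigl => b; rewrite rw_edgeL.
have -> : \sum_(a | a != v) \sum_(b | (b != v) && rw_edge c v W a b) x a * x b =
    \sum_(a | a != v) \sum_(b | (b != v) && cj_edge c a b) x a * x b.
  apply: eq_bigr => a av; apply: eq_bigl => b; case: (boolP (b != v)) => //= bv.
  by rewrite rw_edge_other.
by ring.
Qed.

(** Vector and colouring vary together, so that the formula serves both for recolouring a vertex and
    for composing [x] with a transposition. In either case an amount [t] passes from class [j] to
    class [l]. *)
Lemma spread_shift x x' c c' j l t : j != l ->
  (forall i, cweight x' c' i = cweight x c i + ((i == l)%:R - (i == j)%:R) * t) ->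
  \sum_i cweight x' c' i = \sum_i cweight x c i /\
  spread x' c' = spread x c + 2 * t * (cweight x c l - cweight x c j + t).
Proof.
move=> jl cE; have pick (F : 'I_r -> R) k : \sum_i (i == k)%:R * F i = F k.
  rewrite (bigD1 k) //= eqxx mul1r big1 ?addr0 // => i /negbTE ->.
  by rewrite mul0r.
have sE : \sum_i cweight x' c' i = \sum_i cweight x c i.
  rewrite (eq_bigr _ (fun i _ => cE i)) big_split /= -mulr_suml sumrB.
  rewrite -[\sum_i (i == l)%:R](eq_bigr _ (fun i _ => mulr1 _)).
  rewrite -[\sum_i (i == j)%:R](eq_bigr _ (fun i _ => mulr1 _)).
  by rewrite !(pick (fun=> 1)) subrr mul0r addr0.
split=> //; rewrite /spread sE addrAC; congr (_ - _).
rewrite (eq_bigr (fun i => cweight x c i ^+ 2 +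
   ((i == l)%:R * (2 * t * cweight x c i + t ^+ 2) -
    (i == j)%:R * (2 * t * cweight x c i - t ^+ 2)))); last first.
  move=> i _; rewrite cE; case: (eqVneq i l) => [->|_].
    by rewrite eq_sym (negbTE jl) /=; ring.
  by case: (i == j) => /=; ring.
by rewrite big_split sumrB /= !pick; ring.
Qed.

(** Here [t] leaves class [j] for the cut, which recovers its products with all the other
    classes. *)
Lemma spread_drop x x' c c' j t :
  (forall i, cweight x' c' i = cweight x c i - (i == j)%:R * t) ->
  \sum_i cweight x' c' i = \sum_i cweight x c i - t /\
  spread x' c' = spread x c + 2 * t * (\sum_i cweight x c i - cweight x c j).
Proof.
move=> cE; have pick (F : 'I_r -> R) k : \sum_i (i == k)%:R * F i = F k.
  rewrite (bigD1 k) //= eqxx mul1r big1 ?addr0 // => i /negbTE ->.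
  by rewrite mul0r.
have sE : \sum_i cweight x' c' i = \sum_i cweight x c i - t.
  rewrite (eq_bigr _ (fun i _ => cE i)) sumrB; congr (_ - _).
  by rewrite (pick (fun=> t)).
split=> //; rewrite /spread sE.
rewrite (eq_bigr (fun i => cweight x c i ^+ 2 -
    (i == j)%:R * (2 * t * cweight x c i - t ^+ 2))); last first.
  by move=> i _; rewrite cE; case: (i == j) => /=; ring.
by rewrite sumrB /= !pick; ring.
Qed.

Lemma cweight_tperm x c a b i :
  cweight (x \o tperm a b) c i =
  cweight x c i + ((c a == Some i)%:R - (c b == Some i)%:R) * (x b - x a).
Proof.
have [->|ab] := eqVneq a b.
  rewrite tperm1 !subrr mulr0 addr0; apply: eq_bigr => z _.
  by rewrite /= perm1.
rewrite /cweight !(big_mkcond (fun z => c z == Some i)) /=.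
have ba : b != a by rewrite eq_sym.
rewrite !(bigD1 a isT) /= !(bigD1 (P := fun z => z != a) b ba) /=.
rewrite tpermL tpermR -!addrA.
have -> : \sum_(z | (z != a) && (z != b)) (if c z == Some i then x (tperm a b z) else 0)
        = \sum_(z | (z != a) && (z != b)) (if c z == Some i then x z else 0).
  by apply: eq_bigr => z /andP[za zb]; rewrite tpermD // eq_sym.
by case: (c a == Some i); case: (c b == Some i) => /=; ring.
Qed.

Lemma sum_tperm x a b : \sum_z (x \o tperm a b) z = \sum_z x z.
Proof. by rewrite [RHS](reindex_inj (@perm_inj _ (tperm a b))). Qed.

Definition recolor c y l : V -> option 'I_r :=
  fun z => if z == y then Some l else c z.

Lemma cweight_recolor x c y l i :
  cweight x (recolor c y l) i =
  cweight x c i + ((i == l)%:R - (c y == Some i)%:R) * x y.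
Proof.
rewrite /cweight !(big_mkcond (fun z => _ == Some i)) /= !(bigD1 y isT) /=.
have -> : \sum_(z | z != y) (if recolor c y l z == Some i then x z else 0) =
    \sum_(z | z != y) (if c z == Some i then x z else 0).
  by apply: eq_bigr => z /negbTE zy; rewrite /recolor zy.
have -> : (recolor c y l y == Some i) = (i == l) by rewrite /recolor eqxx eq_sym.
by case: (i == l); case: (c y == Some i) => /=; ring.
Qed.

End Quad.
End CliqueJoin.

(** * Local improvements of an optimal configuration *)

Section Admissible.
Variables (V : finType) (r g k delta : nat).
Implicit Types (c : V -> option 'I_r) (v : V) (W : {set V}).

Definition fiber c z : {set V} := [set a | c a == z].

(* When the cut is [[set v]], [adm_hit] is what keeps [rewired c v W] connected,
   hence its Perron vector positive. *)
Record admissible c v W : Prop := Admissible {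
  adm_cut : #|fiber c None| = k;
  adm_class : forall i, g < #|fiber c (Some i)|;
  adm_notin : v \notin W;
  adm_deg : #|W| = delta;
  adm_hit : c v = None -> k = 1 -> forall i, exists2 a, a \in W & c a = Some i;
  adm_own : forall i, c v = Some i ->
    W \subset fiber c None :|: fiber c (Some i) /\ g <= #|W :&: fiber c (Some i)| }.

(** A cut vertex other than [v] is adjacent to everything except perhaps [v], and [v] has some
    neighbour. Without such a vertex the cut is [{v}], and [adm_hit] links [v] to every class. *)
Lemma admissible_connected c v W : 0 < k -> 0 < delta -> admissible c v W ->
  connected_graph (rewired c v W).
Proof.
move=> k_gt0 d_gt0 [cut _ vW degW hit own].
have csym := sym_connect_sym (@rw_edge_sym V r c v W).
suff [d dP] : exists d, forall z, connect (rw_edge c v W) z d.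
  by move=> a b; apply: connect_trans (dP a) _; rewrite csym.
have [w wW] : exists w, w \in W by apply/card_gt0P; rewrite degW.
have wv : w != v by apply: contraNneq vW => <-.
have vw : rw_edge c v W v w by rewrite rw_edgeL.
have from_cut d : d != v -> c d = None -> forall z, connect (rw_edge c v W) z d.
  move=> dv cd; have zd z : z != v -> connect (rw_edge c v W) z d.
    move=> zv; have [->//|z_d] := eqVneq z d; apply: connect1.
    by rewrite rw_edge_other // /cj_edge z_d cd eqxx orbT.
  move=> z; have [->|] := eqVneq z v; last exact: zd.
  by apply: connect_trans (connect1 vw) _; exact: zd.
have [/existsP[d /andP[dv /eqP cd]]|/existsPn noD] :=
    boolP [exists d, (d != v) && (c d == None)].
  by exists d; exact: from_cut.
have Dv d : c d = None -> d = v.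
  by move=> cd; have := noD d; rewrite cd eqxx andbT negbK => /eqP.
have cv : c v = None.
  have /card_gt0P[d] : 0 < #|fiber c None| by rewrite cut.
  by rewrite inE => /eqP cd; rewrite -(Dv d cd).
have k1 : k = 1.
  rewrite -cut; apply/eqP/cards1P; exists v; apply/setP => d; rewrite !inE.
  by apply/eqP/eqP => [/Dv|->].
exists v => z; have [->//|zv] := eqVneq z v.
case cz: (c z) => [i|]; last by rewrite (Dv z cz).
have [a aW ca] := hit cv k1 i.
have av : a != v by apply: contraNneq vW => <-.
have va : connect (rw_edge c v W) a v.
  by rewrite csym; apply: connect1; rewrite rw_edgeL.
have [->//|za] := eqVneq z a; apply: connect_trans va; apply: connect1.
by rewrite rw_edge_other // /cj_edge za cz ca eqxx !orbT.
Qed.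

Section Optimal.
Variable R : realType.
Local Open Scope ring_scope.

Definition optimal c v W : Prop := admissible c v W /\
  forall c' v' W', admissible c' v' W' ->
    spectral_radius R (rewired c' v' W') <= spectral_radius R (rewired c v W).

Lemma exists_optimal c v W : admissible c v W ->
  exists c' v' W', optimal c' v' W'.
Proof.
move=> adm.
pose T := ({ffun V -> option 'I_r} * V * {set V})%type.
pose P (t : T) := `[< admissible t.1.1 t.1.2 t.2 >].
pose t0 : T := ([ffun a => c a], v, W).
have ffE c' : ([ffun a => c' a] : V -> option 'I_r) = c'.
  by apply: funext => a; rewrite ffunE.
have Pt0 : P t0 by apply/asboolP; rewrite /= ffE.
have [t /asboolP Pt t_max] := @Order.TotalTheory.arg_maxP _ R _ t0 P
  (fun t : T => spectral_radius R (rewired t.1.1 t.1.2 t.2)) Pt0.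
exists t.1.1, t.1.2, t.2; split=> // c' v' W' adm'.
have := t_max ([ffun a => c' a], v', W'); rewrite /= ffE; apply.
by apply/asboolP; rewrite /= ffE.
Qed.

Section Improvement.
Variables (c : V -> option 'I_r) (v : V) (W : {set V}) (x : V -> R).
Hypothesis opt : optimal c v W.
Hypothesis x_gt0 : forall a, 0 < x a.
Let rho := spectral_radius R (rewired c v W).
Hypothesis xE : forall a, \sum_(b | rw_edge c v W a b) x b = rho * x a.

(** A permutation changes neither the sum of [x] nor the sum of its squares, so the two quadratic
    forms differ exactly by the energies, and [x \o s] is a legitimate test vector for the
    competitor. *)
Lemma optimal_energy c' v' W' (s : {perm V}) : admissible c' v' W' ->
  energy (x \o s) c' v' W' <= energy x c v W /\
  (energy (x \o s) c' v' W' = energy x c v W ->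
   forall a, \sum_(b | rw_edge c' v' W' a b) x (s b) = rho * x (s a)).
Proof.
move=> adm'; have [adm /(_ _ _ _ adm') le_rho] := opt.
have sumE (F : V -> R) : \sum_a F (s a) = \sum_a F a.
  by rewrite [RHS](reindex_inj (@perm_inj _ s)).
have quadE : quad (G := rewired c v W) x = rho * \sum_a x a ^+ 2.
  rewrite mulr_sumr; apply: eq_bigr => a _.
  by rewrite -mulr_sumr (xE a) expr2 mulrCA.
have quad'E := quad_rewired (x \o s) c' (adm_notin adm').
rewrite (sumE x) (sumE (fun a => x a ^+ 2)) in quad'E.
rewrite (quad_rewired x c (adm_notin adm)) in quadE.
have test : energy x c v W <= energy (x \o s) c' v' W' ->
    rho <= spectral_radius R (rewired c' v' W') /\
    (spectral_radius R (rewired c' v' W') = rho ->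
     forall a, \sum_(b | rw_edge c' v' W' a b) x (s b) = rho * x (s a)).
  move=> le_e; apply: (@test_vector R (rewired c' v' W') (x \o s) rho).
    by exists v; rewrite /= gt_eqF.
  rewrite (sumE (fun a => x a ^+ 2)) -quadE quad'E.
  by rewrite lerD2l.
split=> [|eqe].
  rewrite leNgt; apply/negP => lt_e.
  have [rho_le eigen] := test (ltW lt_e).
  have /eigen {}eigen : spectral_radius R (rewired c' v' W') = rho.
    by apply/le_anti; rewrite le_rho.
  have quad'E2 : quad (G := rewired c' v' W') (x \o s) = rho * \sum_a x a ^+ 2.
    rewrite -(sumE (fun a => x a ^+ 2)) mulr_sumr; apply: eq_bigr => a _.
    by rewrite -mulr_sumr /= (eigen a) expr2 mulrCA.
  move: lt_e; rewrite quad'E2 -quadE in quad'E.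
  by move/addrI: quad'E => ->; rewrite ltxx.
have [|rho_le eigen] := test; first by rewrite eqe.
by apply: eigen; apply/le_anti; rewrite le_rho.
Qed.

(** [v] is left out because its neighbourhood is [W] whatever the classes are: a vertex that changes
    class neither gains nor loses it. *)
Definition own_weight i := cweight x c i - (c v == Some i)%:R * x v.

(** The energy changes by [2 * x y * (own_weight l - own_weight j + x y)]; the last summand makes
    the conclusion strict. *)
Lemma move_lt y j l : y != v -> c y = Some j -> j != l ->
  admissible (recolor c y l) v W -> own_weight l < own_weight j.
Proof.
move=> yv cy jl /(optimal_energy 1)[+ _].
have -> : x \o (1%g : {perm V}) = x by apply: funext => a; rewrite /= perm1.
have cE i : cweight x (recolor c y l) i =
    cweight x c i + ((i == l)%:R - (i == j)%:R) * x y.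
  rewrite cweight_recolor cy (_ : (Some j == Some i) = (i == j)) //.
  by rewrite eq_sym.
have [sE spE] := spread_shift jl cE.
have nE : nweight x (recolor c y l) v = nweight x c v +
    ((c v == Some l)%:R - (c v == Some j)%:R) * x y.
  rewrite /nweight /recolor eq_sym (negbTE yv).
  case cv: (c v) => [i|] /=; last by rewrite subrr mul0r addr0.
  by rewrite sE cE /=; ring.
rewrite /energy spE nE /own_weight => le_e.
have := x_gt0 y; rewrite -subr_gt0 => y_gt0.
rewrite -subr_gt0 -(pmulr_rgt0 _ (x_gt0 y)).
by move: le_e (x_gt0 y); nra.
Qed.

Lemma card_relink a b : a \in W -> b \notin W -> #|b |: (W :\ a)| = #|W|.
Proof.
by move=> aW bW; rewrite cardsU1 !inE (negbTE bW) andbF (cardsD1 a W) aW.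
Qed.

Lemma sum_relink (f : V -> R) a b : a \in W -> b \notin W ->
  \sum_(z in b |: (W :\ a)) f z = \sum_(z in W) f z + f b - f a.
Proof.
move=> aW bW; rewrite big_setU1 /=; last by rewrite !inE (negbTE bW) andbF.
by rewrite (big_setD1 a aW) /=; ring.
Qed.

(** The energy changes by [2 * x v * (x b - x a)]. If this were zero, [x] would remain an
    eigenvector for the same eigenvalue, although [b] has gained the neighbour [v] and lost none. *)
Lemma relink_lt a b : a \in W -> b \notin W -> b != v ->
  admissible c v (b |: (W :\ a)) -> x b < x a.
Proof.
move=> aW bW bv /(optimal_energy 1)[].
have vW := adm_notin opt.1.
have -> : x \o (1%g : {perm V}) = x by apply: funext => z; rewrite /= perm1.
rewrite /energy sum_relink // => le_e eigen; rewrite ltNge; apply/negP => le_ab.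
have {}/eigen/(_ b) : spread x c + 2 * x v * (\sum_(z in W) x z + x b - x a - nweight x c v)
    = spread x c + 2 * x v * (\sum_(z in W) x z - nweight x c v).
  by apply/le_anti; rewrite le_e /=; have := x_gt0 v; nra.
rewrite perm1 -xE => /eqP; rewrite gt_eqF //.
rewrite [ltRHS](bigD1 v) /=; last first.
  by rewrite rw_edge_sym rw_edgeL ?setU11 // !inE negb_or eq_sym bv (negbTE vW) andbF.
rewrite perm1 (eq_bigl (fun z => rw_edge c v (b |: W :\ a) b z && (z != v))); last first.
  move=> z; have [->|zv] := eqVneq z v.
    by rewrite andbF rw_edge_sym rw_edgeL // (negbTE bW).
  by rewrite !rw_edge_other // andbT.
by rewrite [X in _ < _ + X](eq_bigr x) ?ltrDr // => z _; rewrite perm1.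
Qed.

Lemma cweight_gt0 i : 0 < cweight x c i.
Proof.
have /card_gt0P[a] : (0 < #|fiber c (Some i)|)%N.
  by apply: leq_ltn_trans (adm_class opt.1 i).
rewrite inE => ca; rewrite /cweight (bigD1 a) //= ltr_wpDr //.
by apply: sumr_ge0 => z _; exact: ltW.
Qed.

Lemma sum_swap a b : a \in W -> b \notin W ->
  \sum_(z in b |: (W :\ a)) (x \o tperm a b) z = \sum_(z in W) x z.
Proof.
move=> aW bW; rewrite sum_relink // /= tpermL tpermR.
rewrite (big_setD1 a aW) [RHS](big_setD1 a aW) /= tpermL.
rewrite [X in _ + X + _ - _](eq_bigr x); first by ring.
move=> z; rewrite !inE => /andP[za zW]; rewrite tpermD // eq_sym //.
by apply: contraNneq bW => <-.
Qed.

(* Exchanging the classes of [a] and [b] gives the same graph, up to isomorphism,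
   as redirecting the edge [va] to [vb]: this covers the case [x b < x a] left
   open by [relink_lt]. *)
Lemma relink_join a b j l : a \in W -> b \notin W -> b != v ->
    c a = Some j -> c b = None -> c v = None \/ c v = Some j ->
    j != l -> admissible c v (b |: (W :\ a)) -> False.
Proof.
move=> aW bW bv ca cb cv jl adm'; have lt_ba := relink_lt aW bW bv adm'.
have [+ _] := optimal_energy (tperm a b) adm'.
have av : a != v by apply: contraNneq (adm_notin opt.1) => <-.
have cE i : cweight (x \o tperm a b) c i = cweight x c i - (i == j)%:R * (x a - x b).
  rewrite cweight_tperm ca cb (_ : (Some j == Some i) = (i == j)) 1?eq_sym //=.
  by ring.
have [sE spE] := spread_drop cE.
(* If [v] lies in class [j], this class and the total of all classes lose the same amount, which
   cancels. For [v] in a third class the weight would change, whence the condition on [c v]. *)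
have nE : nweight (x \o tperm a b) c v = nweight x c v.
  rewrite /nweight sum_tperm sE /= tpermD //.
  by case: cv => -> //; rewrite cE eqxx /=; ring.
rewrite /energy spE nE sum_swap //= tpermD // => le_e.
(* The larger entry [x a] enters the cut and is thereby joined to class [l], whose weight is
   positive: the gain is strict. *)
have le_l : cweight x c l <= \sum_i cweight x c i - cweight x c j.
  rewrite (bigD1 j) //= addrAC subrr add0r (bigD1 l) 1?eq_sym //= lerDl.
  by apply: sumr_ge0 => i _; apply: sumr_ge0 => z _; exact: ltW.
have l_gt0 := cweight_gt0 l.
by move: lt_ba; nra.
Qed.

(** Again [a] and [b] exchange their entries. The weight of [W] is unaffected, and the surplus
    [x a - x b] passes to a class that is at least as heavy, which increases the spread. *)
Lemma relink_class a b j l : a \in W -> b \notin W ->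
    c a = Some j -> c b = Some l -> c v = None ->
    j != l -> cweight x c j <= cweight x c l ->
    admissible c v (b |: (W :\ a)) -> False.
Proof.
move=> aW bW ca cb cv jl le_jl adm'.
have bv : b != v by apply: contra_eq_neq cv => <-; rewrite cb.
have lt_ba := relink_lt aW bW bv adm'.
have [+ _] := optimal_energy (tperm a b) adm'.
have av : a != v by apply: contraNneq (adm_notin opt.1) => <-.
have cE i : cweight (x \o tperm a b) c i =
    cweight x c i + ((i == l)%:R - (i == j)%:R) * (x a - x b).
  rewrite cweight_tperm ca cb (_ : (Some j == Some i) = (i == j)) 1?eq_sym //=.
  by rewrite (_ : (Some l == Some i) = (i == l)) 1?eq_sym //=; ring.
have [sE spE] := spread_shift jl cE.
rewrite /energy spE sum_swap // {1}/nweight cv sum_tperm /= tpermD // /nweight cv.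
by move: lt_ba; nra.
Qed.
End Improvement.
End Optimal.
End Admissible.

(** * Structure of the optimal configurations *)

Section Structure.
Variables (V : finType) (r g k delta : nat).
Implicit Types (c : V -> option 'I_r) (v : V) (W : {set V}).

Lemma admissible_recolor c v W y j l : @admissible V r g k delta c v W ->
    y != v -> y \notin W -> c y = Some j -> j != l -> g.+1 < #|fiber c (Some j)| ->
  admissible g k delta (recolor c y l) v W.
Proof.
move=> [cut cls vW degW hit own] yv yW cy jl big_j.
have cW a : a \in W -> recolor c y l a = c a.
  by rewrite /recolor; case: eqVneq => // -> yW'; rewrite yW' in yW.
have cv : recolor c y l v = c v by rewrite /recolor eq_sym (negbTE yv).
have fib z : z != Some j -> fiber c z \subset fiber (recolor c y l) z.
  move=> zj; apply/subsetP => a; rewrite !inE /recolor.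
  by case: (eqVneq a y) => [->|//]; rewrite cy eq_sym (negbTE zj).
split=> //.
- rewrite -cut; apply: eq_card => a; rewrite !inE /recolor.
  by case: (eqVneq a y) => [->|//]; rewrite cy.
- move=> i; have [->|ij] := eqVneq i j; last first.
    by apply: leq_trans (cls i) _; apply: subset_leq_card; exact: fib.
  rewrite (cardsD1 y) inE cy eqxx ltnS in big_j; apply: leq_trans big_j _.
  apply: subset_leq_card; apply/subsetP => a; rewrite !inE /recolor => /andP[/negbTE ->].
  exact.
- by rewrite cv => cv0 k1 i; have [a aW ca] := hit cv0 k1 i; exists a; rewrite ?cW.
- move=> i; rewrite cv => cvi; have [sub card] := own i cvi; split.
    apply/subsetP => a aW; have := subsetP sub a aW.
    by rewrite !inE cW.
  rewrite (leq_trans card) // subset_leq_card //; apply/subsetP => a.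
  by rewrite !inE => /andP[aW]; rewrite cW // aW.
Qed.

Variable R : realType.
Local Open Scope ring_scope.
Variables (c : V -> option 'I_r) (v : V) (W : {set V}) (x : V -> R).
Hypothesis opt : optimal g k delta R c v W.
Hypothesis x_gt0 : forall a, 0 < x a.
Let rho := spectral_radius R (rewired c v W).
Hypothesis xE : forall a, \sum_(b | rw_edge c v W a b) x b = rho * x a.
Hypothesis r_gt1 : (1 < r)%N.
Hypothesis delta_lt : (delta < g + k)%N.

Let D := fiber c None.
Let C i := fiber c (Some i).

Lemma exists_other (i : 'I_r) : exists j : 'I_r, i != j.
Proof.
have r_gt0 := ltnW r_gt1; have [i0|i0] := eqVneq (i : nat) 0%N.
  by exists (Ordinal r_gt1); apply/eqP => /(congr1 val); rewrite /= i0.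
by exists (Ordinal r_gt0); apply/eqP => /(congr1 val) /eqP; rewrite /= (negbTE i0).
Qed.

Lemma exists_notin_W i : (#|W :&: C i| < #|C i|)%N -> exists2 a, a \notin W & c a = Some i.
Proof.
rewrite -(cardsID W (C i)) setIC -[X in (X < _)%N]addn0 ltn_add2l card_gt0.
by move=> /set0Pn[a]; rewrite !inE => /andP[aW /eqP ca]; exists a.
Qed.

(** If [W] met a class and missed a cut vertex, [relink_join] would apply. The bound [g] comes from
    [delta < g + k]: once [W] contains the [k - 1] other cut vertices, at most [delta - k + 1]
    neighbours remain. *)
Lemma cut_neighborhood : c v = None ->
  (W \subset D \/ D :\ v \subset W) /\ (#|W :\: D| <= g)%N.
Proof.
move=> cv; have [cut _ vW degW _ _] := opt.1.
have subs : W \subset D \/ D :\ v \subset W.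
  have [|/subsetPn[a aW aD]] := boolP (W \subset D); first by left.
  right; apply/subsetP => b; rewrite !inE => /andP[bv /eqP cb].
  apply: contraT => bW; case ca: (c a) => [j|]; last by move: aD; rewrite inE ca.
  have [l jl] := exists_other j.
  case: (relink_join opt x_gt0 xE aW bW bv ca cb (or_introl cv) jl).
  split; rewrite ?card_relink //; try exact: (adm_cut opt.1).
  - exact: (adm_class opt.1).
  - by rewrite !inE negb_or eq_sym bv (negbTE vW) andbF.
  (* With [k = 1] the cut is [{v}], so the cut vertex [b] distinct from [v] cannot exist. *)
  - move=> _ k1; have := cut; rewrite k1 => /eqP/cards1P[d Dd].
    have : v \in fiber c None by rewrite inE cv.
    have : b \in fiber c None by rewrite inE cb.
    by rewrite Dd !inE => /eqP bd /eqP vd; rewrite vd bd eqxx in bv.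
  - by move=> i; rewrite cv.
split=> //; case: subs => sub.
  have /eqP -> : W :\: D == set0 by rewrite setD_eq0.
  by rewrite cards0.
have vD : v \in D by rewrite inE cv.
have : (#|D :\ v| <= #|W :&: D|)%N.
  by apply: subset_leq_card; rewrite subsetI sub subsetDl.
have := cardsID D W; have := cardsD1 v D; rewrite vD degW cut.
by lia.
Qed.

Lemma exists_max_cweight (P : pred 'I_r) i0 : P i0 ->
  exists2 j, P j & forall i, P i -> cweight x c i <= cweight x c j.
Proof.
move=> Pi0.
have [j Pj j_max] := @Order.TotalTheory.arg_maxP _ R _ i0 P (cweight x c) Pi0.
by exists j.
Qed.

(** The heaviest class [j1] attracts vertices and edges from all the others, down to what
    admissibility demands: [g + 1] vertices each, and one edge to [v] when [k = 1]. A class has more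
    than [g] vertices, hence one outside [W] that is free to move or to be linked. *)
Lemma structure_cut : c v = None ->
  exists2 j1, forall j, cweight x c j <= cweight x c j1 &
    [/\ forall j, j != j1 -> #|C j| = g.+1,
        forall j, j != j1 -> k != 1%N -> [disjoint W & C j],
        forall j, j != j1 -> k = 1%N -> #|W :&: C j| = 1%N,
        forall i, (#|W :&: C i| < #|C i|)%N
      & W \subset D \/ D :\ v \subset W].
Proof.
move=> cv; have [cut cls vW degW hit _] := opt.1.
have [subs WD] := cut_neighborhood cv.
have WC i : (#|W :&: C i| < #|C i|)%N.
  apply: leq_ltn_trans (cls i); apply: leq_trans WD; apply: subset_leq_card.
  by apply/subsetP => a; rewrite !inE => /andP[-> /eqP ->].
have [j1 _ j1max] := @exists_max_cweight predT (Ordinal (ltnW r_gt1)) isT.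
have ownE i : own_weight c v x i = cweight x c i by rewrite /own_weight cv mul0r subr0.
exists j1 => [j|]; first exact: j1max.
(* The last premise preserves [adm_hit]: for [k = 1] class [j] must retain a neighbour of [v] other
   than [a]. *)
have relink a b j : a \in W -> c a = Some j -> j != j1 -> b \notin W -> c b = Some j1 ->
    (k = 1%N -> exists2 a', a' \in W & (a' != a) && (c a' == Some j)) -> False.
  move=> aW ca jj1 bW cb hit'.
  have bv : b != v by apply: contra_eq_neq cv => <-; rewrite cb.
  apply: (relink_class opt x_gt0 xE aW bW ca cb cv jj1 (j1max j isT)).
  split; rewrite ?card_relink //.
  - by rewrite !inE negb_or eq_sym bv (negbTE vW) andbF.
  - move=> _ k1 i; have [->|ij] := eqVneq i j.
      by have [a' a'W /andP[a'a /eqP ca']] := hit' k1; exists a'; rewrite // !inE a'a a'W orbT.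
    have [a' a'W ca'] := hit cv k1 i; exists a' => //; rewrite !inE a'W andbT orbC.
    by rewrite (_ : a' != a) //; apply: contraNneq ij => a'a; move: ca'; rewrite a'a ca => -[->].
  - by move=> i; rewrite cv.
have [b bW cb] := exists_notin_W (WC j1).
split=> //.
- move=> j jj1; apply/eqP; rewrite eqn_leq cls andbT leqNgt; apply/negP => big_j.
  have [y yW cy] := exists_notin_W (WC j).
  have yv : y != v by apply: contra_eq_neq cv => <-; rewrite cy.
  have := move_lt opt x_gt0 xE yv cy jj1 (admissible_recolor opt.1 yv yW cy jj1 big_j).
  by rewrite !ownE ltNge j1max.
- move=> j jj1 k1; apply/pred0P => a; apply/negP => /andP[/= aW].
  rewrite inE => /eqP ca; apply: (relink a b j) => // k1'.
  by rewrite k1' in k1.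
- move=> j jj1 k1; have [a aW ca] := hit cv k1 j.
  apply/eqP/cards1P; exists a; apply/setP => a'; rewrite !inE; apply/andP/eqP => [|->]; last first.
    by rewrite aW ca.
  move=> [a'W ca']; apply/eqP; apply: contraT => a'a; case: (relink a b j) => // _.
  by exists a' => //; rewrite a'a ca'.
Qed.

Lemma cweightE (f : V -> R) i : cweight f c i = \sum_(a in C i) f a.
Proof. by apply: eq_bigl => a; rewrite inE. Qed.

Lemma sum_cutE (f : V -> R) :
  \sum_a f a - \sum_i cweight f c i = \sum_(a in D) f a.
Proof.
rewrite sum_cweight (bigID (fun a => c a != None)) /= addrAC subrr add0r.
by apply: eq_bigl => a; rewrite inE negbK.
Qed.

Lemma sum_subset_le (A B : {set V}) : A \subset B ->
  \sum_(a in A) x a <= \sum_(a in B) x a.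
Proof.
move=> sub; rewrite [leRHS](big_setID A) /= (finset.setIidPr sub) lerDl.
by apply: sumr_ge0 => a _; exact: ltW.
Qed.

(** * Competitors whose low-degree vertex lies in a class of size g + 1 *)

Section Exchange.
Variables (u : V) (j : 'I_r) (Y : {set V}).
Hypotheses (cu : c u = Some j) (Cj : #|C j| = g.+1).
Hypotheses (YD : Y \subset D) (cardY : (#|Y| + g)%N = delta).

Lemma notin_exchange : u \notin Y :|: C j :\ u.
Proof.
rewrite !inE eqxx orbF; apply/negP => /(subsetP YD).
by rewrite inE cu.
Qed.

Lemma disjoint_exchange : [disjoint Y & C j :\ u].
Proof.
apply/pred0P => a; apply/negP => /andP[/= /(subsetP YD)].
by rewrite !inE => /eqP ->; rewrite andbF.
Qed.

Lemma admissible_exchange : admissible g k delta c u (Y :|: C j :\ u).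
Proof.
have uC : u \in C j by rewrite inE cu.
have cardC : #|C j :\ u| = g by have := cardsD1 u (C j); rewrite uC Cj => -[].
split=> [||||cu0|i].
- exact: adm_cut opt.1.
- exact: adm_class opt.1.
- exact: notin_exchange.
- by rewrite cardsU disjoint_setI0 ?disjoint_exchange // cards0 subn0 cardC.
- by rewrite cu in cu0.
rewrite cu => -[<-]; split; first by rewrite setUSS // subsetDl.
by rewrite -{1}cardC subset_leq_card // subsetI subsetUr subsetDl.
Qed.

Lemma sum_exchange (f : V -> R) :
  \sum_(a in Y :|: C j :\ u) f a = \sum_(a in Y) f a + cweight f c j - f u.
Proof.
rewrite (eq_bigl [predU Y & C j :\ u]) ?bigU ?disjoint_exchange //=; last first.
  by move=> a; rewrite !inE.
rewrite cweightE [X in _ = _ + X - _](big_setD1 u) ?inE ?cu //=; ring.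
Qed.

(** [u] stays adjacent to its whole class, so only the cut vertices outside [Y] are missing. *)
Lemma energy_exchange (f : V -> R) :
  energy f c u (Y :|: C j :\ u) =
  spread f c - 2 * f u * (\sum_(a in D) f a - \sum_(a in Y) f a).
Proof. by rewrite /energy sum_exchange /nweight cu -sum_cutE; ring. Qed.

End Exchange.

(** Beyond the [g] compulsory neighbours in its class, [v] prefers the cut, which has room because
    [delta < g + k]. If the class of [v] had more than [g + 1] vertices, it would outweigh every
    other class even without [v]; all the others would then have [g + 1] vertices, and thinning a
    vertex of one of them instead of [v] would pay. *)
Lemma structure_own i0 : c v = Some i0 ->
  exists2 j1, j1 != i0 &
    [/\ #|C i0| = g.+1, forall j, j != i0 -> j != j1 -> #|C j| = g.+1,
        W \subset D :|: C i0 & #|W :&: C i0| = g].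
Proof.
move=> cv; have [cut cls vW degW _ own] := opt.1.
have [subW gW] := own i0 cv.
have [j ij] := exists_other i0.
have vC : v \in C i0 by rewrite inE cv.
have WE : W = (W :&: D) :|: (W :&: C i0) by rewrite -setIUr; apply/esym/setIidPl.
have disjDC A B : [disjoint A :&: D & B :&: C i0].
  apply/pred0P => a; apply/negP => /andP[/=].
  by rewrite !inE => /andP[_ /eqP ->] /andP[].
have cardW : (#|W :&: D| + #|W :&: C i0|)%N = delta.
  by rewrite -degW {3}WE cardsU (disjoint_setI0 (disjDC _ _)) cards0 subn0.
have WC : #|W :&: C i0| = g.
  apply/eqP; rewrite eqn_leq gW andbT leqNgt; apply/negP => big_W.
  have /subsetPn[b bD bW] : ~~ (D \subset W).
    apply/negP => /setIidPr WD; move: cardW; rewrite WD /D cut; lia.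
  have /card_gt0P[a] : (0 < #|W :&: C i0|)%N by apply: leq_trans big_W.
  rewrite !inE => /andP[aW /eqP ca]; move: bD; rewrite inE => /eqP cb.
  have bv : b != v by apply: contra_eq_neq cb => ->; rewrite cv.
  apply: (relink_join opt x_gt0 xE aW bW bv ca cb (or_intror cv) ij).
  split; rewrite ?card_relink // ?cv //.
    by rewrite !inE negb_or eq_sym bv (negbTE vW) andbF.
  move=> _ [<-]; split.
    apply/subsetP => z; rewrite !in_setU in_set1 in_setD1 => /orP[/eqP ->|/andP[_ zW]].
      by rewrite inE cb.
    by have := subsetP subW z zW; rewrite in_setU.
  have : (#|(W :&: C i0) :\ a| <= #|(b |: W :\ a) :&: C i0|)%N.
    apply: subset_leq_card; apply/subsetP => z; rewrite !inE.
    by move=> /andP[-> /andP[-> ->]]; rewrite orbT.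
  apply: leq_trans; rewrite (cardsD1 a) !inE aW ca eqxx add1n in big_W.
  exact: big_W.
have ji : j != i0 by rewrite eq_sym.
have [j1 j1i j1max] := exists_max_cweight (P := fun j => j != i0) ji.
have ownE i : i != i0 -> own_weight c v x i = cweight x c i.
  by rewrite /own_weight cv eq_sym => /negbTE ii0; rewrite (_ : (_ == _) = false) ?mul0r ?subr0.
have ownE0 : own_weight c v x i0 = cweight x c i0 - x v.
  by rewrite /own_weight cv eqxx mul1r.
have notin_class z l : c z = Some l -> l != i0 -> z != v /\ z \notin W.
  move=> cz li; split; first by apply: contraNneq li => zv; rewrite zv cv in cz; case: cz => ->.
  by apply: contra li => /(subsetP subW); rewrite !inE cz => /eqP[->].
have sizes l : l != i0 -> l != j1 -> #|C l| = g.+1.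
  move=> li lj1; apply/eqP; rewrite eqn_leq cls andbT leqNgt; apply/negP => big_l.
  have /card_gt0P[y] : (0 < #|C l|)%N by apply: leq_ltn_trans (cls l).
  rewrite inE => /eqP cy; have [yv yW] := notin_class y l cy li.
  have := move_lt opt x_gt0 xE yv cy lj1 (admissible_recolor opt.1 yv yW cy lj1 big_l).
  by rewrite !ownE // ltNge j1max.
exists j1 => //; split=> //.
apply/eqP; rewrite eqn_leq cls andbT leqNgt; apply/negP => big_i0.
(* In a class of more than [g + 1] vertices some [y] is not a neighbour of [v]; it may be moved to
   any other class, and optimality bounds the weight of that class. *)
have [y] : exists y, y \in (C i0 :\ v) :\: W.
  apply/card_gt0P; have := cardsID W (C i0 :\ v).
  have -> : (C i0 :\ v) :&: W = W :&: C i0.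
    apply/setP => z; rewrite !inE andbC; case: (boolP (z \in W)) => //= zW.
    by case: eqVneq => // zv; rewrite zv (negbTE vW) in zW.
  by move: big_i0; rewrite WC (cardsD1 v) vC; lia.
rewrite !inE => /and3P[yW yv /eqP cy].
have own_lt l : l != i0 -> cweight x c l < cweight x c i0 - x v.
  move=> li; have il : i0 != l by rewrite eq_sym.
  have := move_lt opt x_gt0 xE yv cy il (admissible_recolor opt.1 yv yW cy il big_i0).
  by rewrite ownE0 ownE.
have Cj1 : #|C j1| = g.+1.
  apply/eqP; rewrite eqn_leq cls andbT leqNgt; apply/negP => big_l.
  have /card_gt0P[z] : (0 < #|C j1|)%N by apply: leq_ltn_trans (cls j1).
  rewrite inE => /eqP cz; have [zv zW] := notin_class z j1 cz j1i.
  have := move_lt opt x_gt0 xE zv cz j1i (admissible_recolor opt.1 zv zW cz j1i big_l).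
  by rewrite ownE0 ownE // ltNge ltW ?own_lt.
have /card_gt0P[u] : (0 < #|C j1|)%N by rewrite Cj1.
rewrite inE => /eqP cu; have [uv uW] := notin_class u j1 cu j1i.
have YD : W :&: D \subset D by apply: subsetIr.
have cardY : (#|W :&: D| + g)%N = delta by rewrite -cardW WC.
have adm' := admissible_exchange cu Cj1 YD cardY.
have sumW : \sum_(a in W) x a = \sum_(a in W :&: D) x a + \sum_(a in W :&: C i0) x a.
  rewrite {1}WE (eq_bigl [predU W :&: D & W :&: C i0]) ?bigU //= => a.
  by rewrite in_setU.
have enE : energy x c v W = spread x c + 2 * x v *
    (\sum_(a in W :&: D) x a + \sum_(a in W :&: C i0) x a -
     (\sum_(a in D) x a + cweight x c i0 - x v)).
  by rewrite /energy sumW /nweight cv sum_cutE.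
have gapC : \sum_(a in W :&: C i0) x a < cweight x c i0 - x v.
  rewrite cweightE [X in _ < X - _](big_setD1 v) //= addrAC subrr add0r.
  have -> : W :&: C i0 = ((C i0 :\ v) :\ y) :&: W.
    apply/setP => z; rewrite !inE [RHS]andbC; case: (boolP (z \in W)) => //= zW.
    have -> : z != y by apply: contraNneq yW => <-.
    by have -> : z != v by apply: contraNneq vW => <-.
  rewrite [ltRHS](big_setD1 y) /=; last by rewrite !inE yv cy eqxx.
  apply: (@le_lt_trans _ _ (\sum_(a in (C i0 :\ v) :\ y) x a)); last by rewrite ltrDr.
  by apply: sum_subset_le; exact: subsetIl.
have leD : \sum_(a in W :&: D) x a <= \sum_(a in D) x a by exact: sum_subset_le.
(* The thinned vertex should carry the smaller entry: if [x u] is the larger one, the entries of [u]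
   and [v] are exchanged. *)
have [le_uv|lt_vu] := leP (x u) (x v).
  have [+ _] := optimal_energy opt x_gt0 xE 1 adm'.
  have -> : x \o (1%g : {perm V}) = x by apply: funext => a; rewrite /= perm1.
  rewrite energy_exchange // enE; have := x_gt0 v; nra.
have [+ _] := optimal_energy opt x_gt0 xE (tperm u v) adm'.
have cE i : cweight (x \o tperm u v) c i =
    cweight x c i + ((i == j1)%:R - (i == i0)%:R) * (x v - x u).
  rewrite cweight_tperm cu cv (_ : (Some j1 == Some i) = (i == j1)) 1?eq_sym //=.
  by rewrite (_ : (Some i0 == Some i) = (i == i0)) 1?eq_sym.
have i0j1 : i0 != j1 by rewrite eq_sym.
have [sE spE] := spread_shift i0j1 cE.
have sumY : \sum_(a in W :&: D) (x \o tperm u v) a = \sum_(a in W :&: D) x a.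
  apply: eq_bigr => a; rewrite inE => /andP[aW _]; rewrite /= tpermD //.
    by apply: contraNneq uW => ->.
  by apply: contraNneq vW => ->.
rewrite energy_exchange // -sum_cutE sum_tperm sE sum_cutE sumY spE enE /= tpermL.
have uj1 : x u <= cweight x c j1.
  rewrite cweightE (big_setD1 u) ?inE ?cu //= lerDl.
  by apply: sumr_ge0 => a _; exact: ltW.
have := own_lt j1 j1i; have := x_gt0 v; have := x_gt0 u.
move: lt_vu gapC uj1; set A := cweight x c j1; set B := \sum_(a in W :&: C i0) x a.
set S := cweight x c i0 => lt_vu gapC uj1 xu xv lt_AS le_e.
(* Half the gain, regrouped so that the first term is positive. If the second is negative, the sum
   equals [x u * (S - x v - B) + (x u - x v) * (B - (A - x u))], whose terms are both positive. *)
have {}le_e : x u * (S - x v - (A - x u)) + x v * (A - x u - B) <= 0 by nra.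
have P_gt0 : 0 < S - x v - (A - x u) by lra.
have [le_BA|lt_AB] := leP B (A - x u).
  have := mulr_gt0 xu P_gt0; have : 0 <= x v * (A - x u - B).
    by rewrite mulr_ge0 ?subr_ge0 // ltW.
  by lra.
have : 0 < x u * (S - x v - B) by rewrite mulr_gt0 ?subr_gt0.
have : 0 < (x u - x v) * (B - (A - x u)) by rewrite mulr_gt0 ?subr_gt0.
nra.
Qed.

Lemma exists_subset_card (A : {set V}) n : (n <= #|A|)%N ->
  exists2 B : {set V}, B \subset A & #|B| = n.
Proof.
move=> le_n; exists [set a in take n (enum A)].
  by apply/subsetP => a; rewrite inE => /mem_take; rewrite mem_enum.
by rewrite cardsE (card_uniqP _) ?take_uniq ?enum_uniq // size_takel -?cardE.
Qed.

(** As a cut vertex, [v] is adjacent to [a] before rewiring; at [a], rewiring removes just this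
    edge, and only when [a] is outside [W]. *)
Lemma eigen_other a : c v = None -> a != v ->
  rho * x a = nweight x c a - (a \notin W)%:R * x v.
Proof.
move=> cv av; have vW := adm_notin opt.1.
rewrite -xE -nweightE (bigD1 v (P := cj_edge c a)) /=; last first.
  by rewrite /cj_edge av cv eqxx orbT.
rewrite (bigID (pred1 v)) /=.
have -> : \sum_(b | rw_edge c v W a b && (b != v)) x b =
    \sum_(b | cj_edge c a b && (b != v)) x b.
  apply: eq_bigl => b; case: (boolP (b != v)) => bv; rewrite ?andbF // !andbT.
  by rewrite rw_edge_other.
have [aW|aW] := boolP (a \in W).
  rewrite (big_pred1 v) ?mul0r ?subr0 // => b /=.
  by case: eqVneq => [->|]; rewrite ?andbF // rw_edge_sym rw_edgeL // aW.
rewrite big_pred0 => [|b]; first by rewrite mul1r; ring.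
by case: eqVneq => [->|]; rewrite ?andbF // rw_edge_sym rw_edgeL // (negbTE aW).
Qed.

(* A vertex [u] of a small class enters the cut and [v] takes its place, or [u]
   becomes the low-degree vertex while [v] stays in the cut: the two resulting
   graphs are isomorphic, and the better one is chosen according to the order of
   [x u] and [x v]. *)
Lemma cut_vertex_not_optimal : c v = None -> (g <= delta)%N -> (0 < k)%N -> False.
Proof.
move=> cv g_le k_gt0; have [cut cls vW degW hit _] := opt.1.
have [_ WD] := cut_neighborhood cv.
have [j1 j1max [sizes WC0 _ WC subs]] := structure_cut cv.
have [j j1j] := exists_other j1; have jj1 : j != j1 by rewrite eq_sym.
have Cj := sizes j jj1.
have [u uW cu] := exists_notin_W (WC j).
have [z zW cz] := exists_notin_W (WC j1).
have uv : u != v by apply: contra_eq_neq cv => <-; rewrite cu.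
have zv : z != v by apply: contra_eq_neq cv => <-; rewrite cz.
have zu : z != u by apply: contra_eq_neq cz => ->; rewrite cu; apply: contra_neq jj1 => -[].
have vD : v \in D by rewrite inE cv.
(* At most [g] neighbours of [v] lie outside the cut, so [delta - g] can be kept inside it; together
   with the [g] classmates of [u] they form the new neighbourhood. *)
have [Y YWD cardY'] : exists2 Y : {set V}, Y \subset W :&: D & #|Y| = (delta - g)%N.
  by apply: exists_subset_card; rewrite leq_subLR -degW -(cardsID D W) addnC leq_add2r.
have [YW YD] : Y \subset W /\ Y \subset D by apply/andP; rewrite -subsetI.
have cardY : (#|Y| + g)%N = delta by rewrite cardY' subnK.
have vY : v \notin Y by apply: contra vW => /(subsetP YW).
have adm' := admissible_exchange cu Cj YD cardY.
set X := \sum_a x a; set s := \sum_i cweight x c i.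
pose wD := \sum_(a in D) x a; pose wY := \sum_(a in Y) x a.
pose wW := \sum_(a in W) x a.
have XE : X - s = wD by rewrite /X /s sum_cutE.
have enE : energy x c v W = spread x c + 2 * x v * (wW - X + x v).
  by rewrite /energy /nweight cv -/X -/wW; ring.
have xu := x_gt0 u; have xv := x_gt0 v; have xz := x_gt0 z.
have rhov : rho * x v = wW.
  by rewrite -xE; apply: eq_bigl => b; rewrite rw_edgeL.
have classE i a : c a = Some i -> a \notin W ->
    (rho + 1) * x a = wD + cweight x c i - x v.
  move=> ca aW; have av : a != v by apply: contra_eq_neq cv => <-; rewrite ca.
  rewrite mulrDl mul1r (eigen_other cv av) aW /nweight ca -/X -/s mul1r.
  by rewrite -XE; ring.
(* Thinning [u] instead of [v]: [v] recovers everything it missed, [u] loses the cut outside [Y]. *)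
have gain1 : 0 < x v * (X - x v - wW) - x u * (wD - wY) -> False.
  move=> gain; have [+ _] := optimal_energy opt x_gt0 xE 1 adm'.
  have -> : x \o (1%g : {perm V}) = x by apply: funext => a; rewrite /= perm1.
  by rewrite energy_exchange // enE -/wD -/wY; lra.
have leYD : wY <= wD - x v.
  rewrite /wD (big_setD1 v) //= addrAC subrr add0r; apply: sum_subset_le.
  by apply/subsetP => a aY; rewrite in_setD1 (subsetP YD) // andbT; apply: contraNneq vY => <-.
have leX : x v + wW + x u + x z <= X.
  have -> : x v + wW + x u + x z = \sum_(a in v |: (u |: (z |: W))) x a.
    have vz : v != z by rewrite eq_sym.
    have vu : v != u by rewrite eq_sym.
    have uz : u != z by rewrite eq_sym.
    rewrite !big_setU1 /= ?in_setU1 ?negb_or ?vu ?vz ?vW ?uz ?uW ?zW //.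
    by rewrite /wW; ring.
  rewrite /X [leRHS](eq_bigl (fun a => a \in [set: V])) => [|a]; last by rewrite inE.
  by apply: sum_subset_le; exact: finset.subsetT.
have Y_ge0 : 0 <= wY by apply: sumr_ge0 => a _; exact: ltW.
have [k1|k_neq1] := eqVneq k 1%N.
  apply: gain1; have -> : wD = x v.
    rewrite /wD (_ : D = [set v]) ?big_set1 //; apply/eqP; rewrite eq_sym eqEcard.
    by rewrite finset.sub1set vD cut k1 cards1.
  have : 0 < x v * (X - x v - wW - x u) by rewrite mulr_gt0 //; lra.
  have : 0 <= x u * wY by rewrite mulr_ge0 // ltW.
  by lra.
have D_gt : 0 < wD - x v.
  have /card_gt0P[d dD] : (0 < #|D :\ v|)%N.
    rewrite lt0n; apply: contra_neq k_neq1 => D0.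
    by rewrite -cut (cardsD1 v) vD D0.
  rewrite /wD (big_setD1 v) //= addrAC subrr add0r (big_setD1 d) //= ltr_wpDr //.
  by apply: sumr_ge0 => a _; exact: ltW.
have Cnotin a : c a = Some j -> a \notin W.
  move=> ca; apply/negP => aW; have /pred0P/(_ a) := WC0 j jj1 k_neq1.
  by rewrite /= aW inE ca eqxx.
have sj_gt0 : 0 < cweight x c j by apply: (cweight_gt0 opt).
have rho1_gt0 : 0 < rho + 1.
  by rewrite -(pmulr_lgt0 _ xu) (classE j u cu uW); lra.
(* Class [j] avoids [W], so its vertices satisfy the same eigenvalue equation and [x] is constant on
   it. *)
have sjE : cweight x c j = (g.+1)%:R * x u.
  rewrite cweightE -Cj -sum1_card natr_sum mulr_suml; apply: eq_bigr => a.
  rewrite inE => /eqP ca; rewrite mul1r; apply: (mulfI (lt0r_neq0 rho1_gt0)).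
  by rewrite (classE j a ca (Cnotin a ca)) (classE j u cu uW).
rewrite -addn1 natrD in sjE.
have rho_gt : g%:R < rho.
  rewrite -(ltr_pM2r xu); have := classE j u cu uW; rewrite sjE; lra.
pose S := s - cweight x c j.
have le_sum i l : i != l -> cweight x c i + cweight x c l <= s.
  move=> il; rewrite /s (bigD1 i) //= (bigD1 l) 1?eq_sym //= addrA lerDl.
  by apply: sumr_ge0 => a _; apply: ltW; exact: (cweight_gt0 opt).
have S_ge : cweight x c j1 <= S by have := le_sum _ _ j1j; rewrite /S; lra.
have S_ge' : cweight x c j <= S by apply: le_trans S_ge; exact: j1max.
(* With the entries exchanged, [u] enters the cut and gains the other classes, of weight [S]; [v]
   trades [W :\: Y] for the [g] classmates of [u]. *)
have gain2 : 0 < x u * S + x v * (wY + g%:R * x u - wW) -> False.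
  move=> gain; have [+ _] := optimal_energy opt x_gt0 xE (tperm u v) adm'.
  have cE i : cweight (x \o tperm u v) c i =
      cweight x c i - (i == j)%:R * (x u - x v).
    rewrite cweight_tperm cu cv (_ : (Some j == Some i) = (i == j)) 1?eq_sym //=.
    by ring.
  have [sE spE] := spread_drop cE.
  have sumY : \sum_(a in Y) (x \o tperm u v) a = wY.
    apply: eq_bigr => a aY; rewrite /= tpermD //.
      by apply: contraNneq uW => ->; exact: (subsetP YW).
    by apply: contraNneq vY => ->.
  rewrite energy_exchange // -sum_cutE sum_tperm sE sumY spE enE /= tpermL -/s -/X.
  by move: gain sjE; rewrite /S; nra.
have W_le a : a \in W -> (rho + 1) * x a <= X.
  move=> aW; have av : a != v by apply: contraNneq vW => <-.
  rewrite mulrDl mul1r (eigen_other cv av) aW /= mul0r subr0 /nweight -/X -/s.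
  case ca: (c a) => [i|]; last by lra.
  suff : cweight x c i <= s by lra.
  rewrite /s (bigD1 i) //= lerDl; apply: sumr_ge0 => l _.
  by apply: ltW; exact: (cweight_gt0 opt).
have uE : (rho + 1) * x u = X - S - x v by rewrite (classE j u cu uW) -XE /S; ring.
have sum_le (A : {set V}) : A \subset W ->
    (rho + 1) * (\sum_(a in A) x a) <= #|A|%:R * X.
  move=> /subsetP AW; rewrite mulr_sumr -sum1_card natr_sum mulr_suml.
  by apply: ler_sum => a /AW /W_le; rewrite mul1r.
have g_ge0 : 0 <= g%:R :> R by rewrite ler0n.
(* If [x v <= x u], the second exchange wins: [v] gives up only [g] neighbours, each of entry at
   most [X / (rho + 1)]. Otherwise the first one will. *)
have [le_vu|lt_uv] := leP (x v) (x u).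
  apply: gain2.
  have wWE : wW = wY + \sum_(a in W :\: Y) x a.
    by rewrite /wW (big_setID Y) /= (finset.setIidPr YW).
  have := sum_le (W :\: Y) (subsetDl _ _).
  have -> : #|W :\: Y| = g.
    by rewrite cardsD (finset.setIidPr YW) degW -cardY addKn.
  rewrite wWE; set Z := \sum_(a in W :\: Y) x a => leZ.
  rewrite -(pmulr_rgt0 _ rho1_gt0).
  have S_gt0 : 0 < S by lra.
  have h1 : x v * ((rho + 1) * Z) <= x v * (g%:R * X) by rewrite ler_pM2l.
  have h2 : 0 < (rho - g%:R) * (x u * S).
    by apply: mulr_gt0; [rewrite subr_gt0|exact: mulr_gt0].
  have h3 : 0 <= (x u - x v) * (g%:R * S).
    by apply: mulr_ge0; [rewrite subr_ge0|apply: mulr_ge0 => //; exact: ltW].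
  have h4 : g%:R * x v * x v <= S * x u.
    apply: ler_pM => //; try exact: ltW; first by rewrite mulr_ge0 // ltW.
    apply: le_trans S_ge'; rewrite sjE; apply: (@le_trans _ _ (g%:R * x u)).
      by rewrite ler_wpM2l.
    by rewrite ler_pM2r //; lra.
  have XE2 : X = (rho + 1) * x u + S + x v by lra.
  rewrite XE2 in h1.
  nra.
have rho_gt0 : 0 < rho by apply: le_lt_trans rho_gt.
(* If [W] were inside the cut, then [rho * x v = wW <= wD - x v <= rho * x u], against
   [x u < x v]. *)
have {}subs : D :\ v \subset W.
  case: subs => // WsubD; have leWD : wW <= wD - x v.
    rewrite /wD (big_setD1 v) //= addrAC subrr add0r; apply: sum_subset_le.
    apply/subsetP => a aW; rewrite in_setD1 (subsetP WsubD) // andbT.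
    by apply: contraNneq vW => <-.
  have := classE j u cu uW; rewrite sjE => rhou.
  have : rho * x v <= rho * x u.
    by rewrite rhov; have : 0 <= g%:R * x u by [rewrite mulr_ge0 // ltW]; lra.
  by rewrite ler_pM2l // leNgt lt_uv.
pose E := \sum_(a in D :\ v :\: Y) x a.
have YD' : Y \subset D :\ v.
  by apply/subsetP => a aY; rewrite in_setD1 (subsetP YD) // andbT; apply: contraNneq vY => <-.
have EE : wD = x v + wY + E.
  by rewrite /wD (big_setD1 v) //= (big_setID Y) /= (finset.setIidPr YD') addrA.
set a := #|D :\ v :\: Y|.
have leE : (rho + 1) * E <= a%:R * X.
  by apply: sum_le; apply: subset_trans subs; exact: subsetDl.
(* [W] has [g] vertices outside [Y], and [a] of them are in the cut. Hence class [j1], with more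
   than [g] vertices, has at least [a + 1] outside [W]. *)
have cardWC : (#|W :&: C j1| + a <= g)%N.
  have disj : (D :\ v) :&: (W :&: C j1) = set0.
    apply/setP => b; rewrite !inE; apply/negP.
    by move=> /andP[/andP[_ /eqP ->] /andP[_]].
  have : (#|(D :\ v) :|: (W :&: C j1)| <= #|W|)%N.
    by apply: subset_leq_card; rewrite finset.subUset subs subsetIl.
  rewrite cardsU disj cards0 subn0 degW -cardY.
  rewrite -(cardsID Y (D :\ v)) (finset.setIidPr YD') -addnA leq_add2l.
  by rewrite addnC.
pose M := \sum_(b in C j1 :\: W) x b; pose B := \sum_(b in W :&: C j1) x b.
have s1E : cweight x c j1 = B + M by rewrite cweightE (big_setID W) /= finset.setIC.
have leW : wW <= wD - x v + B.
  rewrite /wW (big_setID (C j1)) /= -/B addrC lerD2r.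
  rewrite /wD [X in _ <= X - _](big_setD1 v) //= addrAC subrr add0r; apply: sum_subset_le.
  apply/subsetP => b; rewrite !inE => /andP[bC bW]; apply/andP; split.
    by apply: contraNneq vW => <-.
  case cb: (c b) => [i|] //; have ij1 : i != j1 by apply: contraNneq bC => <-; rewrite cb.
  by have /pred0P/(_ b) := WC0 i ij1 k_neq1; rewrite /= bW inE cb eqxx.
have z_cls : (rho + 1) * x z = wD + cweight x c j1 - x v := classE j1 z cz zW.
have ME : M = #|C j1 :\: W|%:R * x z.
  rewrite /M -sum1_card natr_sum mulr_suml; apply: eq_bigr => b.
  rewrite !inE => /andP[bW /eqP cb]; rewrite mul1r; apply: (mulfI (lt0r_neq0 rho1_gt0)).
  by rewrite z_cls (classE j1 b cb bW).
have card_ge : (a.+1 <= #|C j1 :\: W|)%N.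
  have := cls j1; rewrite -(cardsID W) finset.setIC => lt_g.
  rewrite -(ltn_add2l #|W :&: C j1|); apply: leq_ltn_trans cardWC _.
  exact: lt_g.
have M_ge : (a%:R + 1) * x z <= M.
  by rewrite ME ler_pM2r // natr1 ler_nat.
have M_le : x z <= M.
  apply: le_trans M_ge; rewrite mulrDl mul1r lerDr mulr_ge0 ?ler0n //.
  exact: ltW.
have le_vz : x v <= x z.
  rewrite -(ler_pM2l rho_gt0) rhov; have : rho * x z = wD - x v + (B + M - x z).
    by rewrite -s1E; lra.
  by lra.
(* [T] is the weight that [v] misses apart from [u] and itself. The gain is [x v * T - x u * E], so
   [E <= T] suffices since [x u < x v]. *)
pose Q := s - cweight x c j1; pose T := X - x v - x u - wW.
have T_gt0 : 0 < T by rewrite /T; lra.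
have Q_ge0 : 0 <= Q by have := le_sum _ _ j1j; rewrite /Q; lra.
have T_ge : Q + M - x u <= T by rewrite /T /Q; lra.
(* After multiplication by [rho + 1], the [a + 1] equal entries in [M] compensate the [a] entries in
   [E]. At least [(rho - a) * Q + S - a * x v] is left, which is nonnegative because [a <= g < rho]
   and [a * x v <= M <= S]. *)
have leET : E <= T.
  rewrite -(ler_pM2l rho1_gt0); apply: le_trans leE _.
  apply: le_trans (_ : _ <= (rho + 1) * (Q + M - x u)) _; last by rewrite ler_pM2l.
  have zE : (rho + 1) * x z = X - Q - x v by rewrite z_cls /Q; lra.
  have h1 : (rho + 1) * ((a%:R + 1) * x z) <= (rho + 1) * M by rewrite ler_pM2l.
  have h2 : a%:R * x v <= M.
    apply: le_trans M_ge; apply: (@le_trans _ _ (a%:R * x z)).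
      by rewrite ler_wpM2l ?ler0n.
    by rewrite mulrDl lerDl mul1r ltW.
  have h3 : 0 <= (rho - a%:R) * Q.
    rewrite mulr_ge0 // subr_ge0; apply: le_trans (ltW rho_gt); rewrite ler_nat.
    exact: leq_trans (leq_addl _ _) cardWC.
  have h4 : M <= S by have : 0 <= B by [apply: sumr_ge0 => b _; exact: ltW]; lra.
  have {}h1 : (a%:R + 1) * (X - Q - x v) <= (rho + 1) * M by rewrite -zE mulrCA.
  have -> : (rho + 1) * (Q + M - x u) = (rho + 1) * Q + (rho + 1) * M - (rho + 1) * x u.
    by ring.
  rewrite uE; lra.
apply: gain1; have -> : x v * (X - x v - wW) - x u * (wD - wY) = x v * T - x u * E.
  by rewrite /T EE; ring.
have h1 : x u * E <= x u * T by rewrite ler_pM2l.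
have h2 : 0 < (x v - x u) * T by apply: mulr_gt0 => //; rewrite subr_gt0.
lra.
Qed.

End Structure.

(** * Isomorphisms and embeddings *)

Section Isomorphism.

(** Within each colour, the element of a given rank is sent to the element of the same rank. *)
Lemma color_injection (A B : finType) (C : eqType) (f : A -> C) (h : B -> C) :
    (forall z, #|[set a | f a == z]| = #|[set b | h b == z]|) ->
  exists2 p : A -> B, injective p & forall a, h (p a) = f a.
Proof.
move=> eq_card.
have [b0|B0] := pickP B; last first.
  have A0 (a : A) : False.
    have /card_gt0P[b _] : 0 < #|[set b | h b == f a]|.
      by rewrite -eq_card; apply/card_gt0P; exists a; rewrite inE.
    by have := B0 b.
  by exists (fun a => False_rect B (A0 a)) => a; case: (A0 a).
pose EA z := enum [set a | f a == z]; pose EB z := enum [set b | h b == z].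
have idx a : index a (EA (f a)) < size (EB (f a)).
  by rewrite -cardE -eq_card cardE index_mem mem_enum inE.
pose p a := nth b0 (EB (f a)) (index a (EA (f a))).
have hp a : h (p a) = f a.
  by have := mem_nth b0 (idx a); rewrite mem_enum inE => /eqP.
exists p => // a a' eqp; have eqf : f a = f a' by rewrite -!hp eqp.
have := idx a'; have := idx a; move: eqp; rewrite /p eqf => /eqP eqp lt1 lt2.
move: eqp; rewrite nth_uniq ?enum_uniq // => /eqP eqi.
have aE : a \in EA (f a') by rewrite mem_enum inE eqf.
have a'E : a' \in EA (f a') by rewrite mem_enum inE.
by rewrite -(nth_index a aE) eqi nth_index.
Qed.

Lemma color_bijection (A B : finType) (C : eqType) (f : A -> C) (h : B -> C) :
    (forall z, #|[set a | f a == z]| = #|[set b | h b == z]|) ->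
  exists2 p : A -> B, bijective p & forall a, h (p a) = f a.
Proof.
move=> eq_card; have [p p_inj hp] := color_injection eq_card.
have [q q_inj _] := color_injection (fun z => esym (eq_card z)).
by exists p => //; apply: inj_card_bij p_inj _; exact: leq_card q_inj.
Qed.

Variables (A B : finType) (r : nat).

Lemma clique_join_isomorphic (c : A -> option 'I_r) (c' : B -> option 'I_r) :
    (forall z, #|[set a | c a == z]| = #|[set b | c' b == z]|) ->
  isomorphic (clique_join c) (clique_join c').
Proof.
move=> /color_bijection[p bij_p c'p]; exists p => // a b.
by rewrite /= /cj_edge !c'p (bij_eq bij_p).
Qed.

(** Apart from equality of vertices, adjacency depends only on the triple (is [v], lies in [W],
    class). Counting the fibres of this triple reduces to the two given families of cardinalities
    and the class of [v]. *)
Lemma rewired_isomorphic (c : A -> option 'I_r) v (W : {set A})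
    (c' : B -> option 'I_r) v' (W' : {set B}) :
    v \notin W -> v' \notin W' -> c v = c' v' ->
    (forall z, #|[set a | c a == z]| = #|[set b | c' b == z]|) ->
    (forall z, #|[set a | (a \in W) && (c a == z)]| =
               #|[set b | (b \in W') && (c' b == z)]|) ->
  isomorphic (rewired c v W) (rewired c' v' W').
Proof.
move=> vW v'W' cvv' eqc eqW.
have split3 (T : finType) (d : T -> option 'I_r) (w : T) (U : {set T}) z : w \notin U ->
    #|[set a | d a == z]| = #|[set a | (a \in U) && (d a == z)]| +
      ((d w == z) + #|[set a | (a == w, a \in U, d a) == (false, false, z)]|).
  move=> wU; rewrite (cardsD1 w [set a | d a == z]) inE addnCA; congr (_ + _).
  rewrite -(cardsID U); congr (_ + _); apply: eq_card => a; rewrite !inE ?xpair_eqE.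
    by case: (eqVneq a w) => [->|]; rewrite ?(negbTE wU) //= andbC.
  by case: (a == w); case: (a \in U).
have [p bij_p colE] : exists2 p : A -> B, bijective p &
    forall a, (p a == v', p a \in W', c' (p a)) = (a == v, a \in W, c a).
  apply: (color_bijection (f := fun a => (a == v, a \in W, c a))
      (h := fun b => (b == v', b \in W', c' b))) => [[[[] []] z]].
  - rewrite !eq_card0 // => a; rewrite !inE !xpair_eqE.
      by case: (eqVneq a v') => [->|]; rewrite ?(negbTE v'W').
    by case: (eqVneq a v) => [->|]; rewrite ?(negbTE vW).
  - have one (T : finType) (d : T -> option 'I_r) (w : T) (U : {set T}) : w \notin U ->
        #|[set a | (a == w, a \in U, d a) == (true, false, z)]| = (d w == z).
      move=> wU; case dz: (d w == z).
        apply/eqP/cards1P; exists w; apply/setP => a; rewrite !inE !xpair_eqE.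
        by case: (eqVneq a w) => [->|]; rewrite ?(negbTE wU) ?dz.
      rewrite eq_card0 // => a; rewrite !inE !xpair_eqE.
      by case: (eqVneq a w) => [->|] //=; rewrite dz andbF.
    by rewrite !one // cvv'.
  - rewrite -[LHS]/(#|[set a | _]|) -[RHS]/(#|[set b | _]|).
    have true_W (T : finType) (d : T -> option 'I_r) (w : T) (U : {set T}) : w \notin U ->
        #|[set a | (a == w, a \in U, d a) == (false, true, z)]| =
        #|[set a | (a \in U) && (d a == z)]|.
      move=> wU; apply: eq_card => a; rewrite !inE !xpair_eqE.
      by case: (eqVneq a w) => [->|]; rewrite ?(negbTE wU) //= eqb_id.
    by rewrite !true_W.
  - have := eqc z; rewrite (split3 _ c v W) // (split3 _ c' v' W') // eqW cvv'.
    by move=> /addnI /addnI.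
exists p => // a b; have [pav paW pac] := colE a; have [pbv pbW pbc] := colE b.
by rewrite /= /rw_edge /cj_edge pav pbv paW pbW pac pbc (bij_eq bij_p).
Qed.

End Isomorphism.

Section Maximal.
Variable R : realType.
Local Open Scope ring_scope.

(** The last premise concerns every maximiser because of the equality case: if [G] attains the
    bound, then [F i0] is itself a maximiser, hence isomorphic to [H], and [G] is isomorphic to
    [F i0]. *)
Lemma spectral_bound_of_maximal (I : Type) (P : I -> Prop) (F : I -> sgraph)
    (G H : sgraph) (i0 : I) (f : G -> F i0) :
    (0 < #|G|)%N -> connected_graph G -> bijective f ->
    (forall x y, edge x y -> edge (f x) (f y)) -> P i0 ->
    (exists2 i, P i & forall i', P i' -> spectral_radius R (F i') <= spectral_radius R (F i)) ->
    (forall i, P i -> (forall i', P i' -> spectral_radius R (F i') <= spectral_radius R (F i)) ->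
      isomorphic (F i) H) ->
  spectral_bound R G H.
Proof.
move=> G_gt0 conG bij_f sub Pi0 [i Pi i_max] isoH.
have rhoH := isomorphic_spectral_radius R (isoH i Pi i_max).
have [le_G eq_G] := spectral_radius_subgraph R G_gt0 conG bij_f sub.
rewrite /spectral_bound -rhoH; have le_i0 := i_max i0 Pi0.
split; first exact: le_trans le_i0.
split=> [rhoG|]; last by move/(isomorphic_spectral_radius R); rewrite rhoH.
have rho0 : spectral_radius R (F i0) = spectral_radius R (F i).
  by apply/le_anti; rewrite le_i0 -rhoG.
apply: isomorphic_trans (eq_G _) _; first by rewrite rho0.
by apply: isoH => // i' Pi'; rewrite rho0; exact: i_max.
Qed.

End Maximal.

(** * Colouring the components left by a good cut *)

Section Embedding.
Variables (G : sgraph) (r : nat) (F : {set G}).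
Hypothesis r_gt0 : 0 < r.
Hypothesis F_comp : r <= num_components (del_vertices F).

(** Components are numbered through their roots, and the surplus ones are merged into the last
    class. The first [r] roots realise the [r] colours. *)
Lemma cut_coloring : exists c : G -> option 'I_r,
  [/\ forall a, (c a == None) = (a \in F),
      forall a b, a \notin F -> b \notin F -> edge a b -> c a = c b
    & forall i, exists a, c a = Some i].
Proof.
case: r r_gt0 F_comp => // r' _ comp.
pose H := del_vertices F; pose e : rel H := edge.
have csym : connect_sym e by apply: sym_connect_sym; exact: edge_sym.
pose cls (x : H) : 'I_r'.+1 := inord (minn (index (fingraph.root e x) (enum (roots e))) r').
pose c (a : G) := omap cls (insub a : option H).
have cE (x : H) : c (val x) = Some (cls x) by rewrite /c valK.
exists c; split.
- move=> a; rewrite /c; case: insubP => [x|] //=; first by move=> /negbTE ->.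
  by rewrite negbK => ->.
- move=> a b aF bF ab; rewrite -[a]/(val (Sub a aF : H)) -[b]/(val (Sub b bF : H)) !cE.
  congr (Some (inord (minn (index _ _) _))); apply/eqP.
  by rewrite root_connect //; apply: connect1.
- move=> i; have size_roots : size (enum (roots e)) = num_components H.
    by rewrite -cardE /num_components /n_comp_mem; apply: eq_card => x; rewrite !inE andbT.
  have lt_i : i < size (enum (roots e)) by rewrite size_roots (leq_trans _ comp).
  have [x0 _] : exists x0 : H, x0 \in roots e.
    apply/card_gt0P; rewrite cardE; exact: leq_ltn_trans lt_i.
  pose x := nth x0 (enum (roots e)) i.
  have : x \in enum (roots e) by apply: mem_nth.
  rewrite mem_enum => /eqP rx; exists (val x); rewrite cE; congr Some.
  apply: val_inj; rewrite /cls rx /x index_uniq ?enum_uniq //.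
  have le_i : i <= r' by rewrite -ltnS.
  by rewrite (minn_idPl le_i) /= inordK.
Qed.

Variables (g k delta : nat) (v : G).
Hypotheses (r_gt1 : 1 < r) (conG : connected_graph G) (cardF : #|F| = k).
Hypothesis F_good : forall a : del_vertices F, g <= deg a.
Hypothesis deg_v : deg v = delta.

Lemma good_degree (a : G) : a \notin F -> g <= #|[set b | edge a b] :\: F|.
Proof.
move=> aF; apply: leq_trans (F_good (Sub a aF)) _.
rewrite /deg -(card_imset _ val_inj); apply: subset_leq_card; apply/subsetP => b.
by move=> /imsetP[x]; rewrite inE => ax ->; rewrite !inE (valP x).
Qed.

(** The neighbours of [a] outside [F] share its class, and [a] itself makes the bound strict. The
    number [m] will be [g] or [delta - k]. *)
Lemma cut_coloring_card m (c : G -> option 'I_r) :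
    (forall a, (c a == None) = (a \in F)) ->
    (forall a b, a \notin F -> b \notin F -> edge a b -> c a = c b) ->
    (forall i, exists a, c a = Some i) ->
    (forall a, a \notin F -> m <= #|[set b | edge a b] :\: F|) ->
  forall i, m < #|fiber c (Some i)|.
Proof.
move=> cF c_edge c_surj le_m i; have [a ca] := c_surj i.
have aF : a \notin F by rewrite -cF ca.
rewrite (cardsD1 a) inE ca eqxx ltnS (leq_trans (le_m a aF)) //.
apply: subset_leq_card; apply/subsetP => b; rewrite !inE => /andP[bF ab].
rewrite -(c_edge a b) // ca eqxx andbT; apply: contraTneq ab => ->.
by rewrite edge_irr.
Qed.

Lemma cut_nonempty : 0 < k.
Proof.
rewrite lt0n; apply: contraT => /negbNE/eqP k0.
have [c [cF c_edge c_surj]] := cut_coloring.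
have F0 a : a \notin F.
  by have /eqP := cardF; rewrite k0 cards_eq0 => /eqP ->; rewrite inE.
have [a ca] := c_surj (Ordinal r_gt1); have [b cb] := c_surj (Ordinal r_gt0).
have : closed (edge : rel G) [pred z | c z == c a].
  by move=> y z yz; rewrite !inE (c_edge y z).
by move/closed_connect => /(_ _ _ (conG a b)); rewrite !inE eqxx cb ca.
Qed.

Lemma min_degree_gt0 : 0 < delta.
Proof.
have [c [_ _ c_surj]] := cut_coloring.
have [a av] : exists a, a != v.
  have [a ca] := c_surj (Ordinal r_gt1); have [b cb] := c_surj (Ordinal r_gt0).
  have ab : a != b by apply: contra_eq_neq ca => ->; rewrite cb.
  by have [av|] := eqVneq a v; [exists b; rewrite -av eq_sym|exists a].
rewrite lt0n -deg_v; apply: contraT => /negbNE; rewrite cards_eq0 => /eqP N0.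
have : closed (edge : rel G) [pred z | z == v].
  have Nv z : edge v z = false by have := in_set0 z; rewrite -N0 inE.
  move=> y z yz; rewrite !inE; case: eqVneq yz => [->|_]; first by rewrite Nv.
  by case: eqVneq => // ->; rewrite edge_sym Nv.
by move/closed_connect => /(_ _ _ (conG v a)); rewrite !inE eqxx (negbTE av).
Qed.

Lemma exists_admissible : exists (c : G -> option 'I_r) (w : G) W,
  admissible g k delta c w W /\ forall a b : G, edge a b -> rw_edge c w W a b.
Proof.
have [c [cF c_edge c_surj]] := cut_coloring.
have cls := cut_coloring_card cF c_edge c_surj good_degree.
exists c, v, [set b | edge v b]; split; last first.
  move=> a b ab; rewrite /rw_edge; have -> /= : a != b.
    by apply: contraTneq ab => ->; rewrite edge_irr.
  have [<-|_] := eqVneq a v; first by rewrite inE.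
  have [<-|_] := eqVneq b v; first by rewrite inE edge_sym.
  rewrite /cj_edge; have -> /= : a != b by apply: contraTneq ab => ->; rewrite edge_irr.
  rewrite !cF; case: (boolP (a \in F)) => //= aF; case: (boolP (b \in F)) => //= bF.
  by rewrite (c_edge a b).
split=> //.
- by rewrite -cardF; apply: eq_card => a; rewrite inE cF.
- by rewrite inE edge_irr.
(* Here [F] is [{v}]: a class without a neighbour of [v] would be closed under adjacency, against
   connectedness. *)
- move=> cv k1 i; have vF : v \in F by rewrite -cF cv.
  have FE a : a \in F -> a = v.
    have /eqP/cards1P[d Fd] := etrans cardF k1.
    by move: vF; rewrite Fd !inE => /eqP -> /eqP ->.
  have [/existsP[a /andP[va /eqP ca]]|/existsPn noa] :=
      boolP [exists a, edge v a && (c a == Some i)].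
    by exists a; rewrite ?inE.
  have [a ca] := c_surj i.
  have : closed (edge : rel G) [pred z | c z == Some i].
    have step y z : edge y z -> c y = Some i -> c z = Some i.
      move=> yz cy; rewrite -cy; apply/esym/c_edge => //; first by rewrite -cF cy.
      apply/negP => /FE zv; have := noa y.
      by rewrite edge_sym -zv yz cy eqxx.
    move=> y z yz; rewrite !inE; apply/eqP/eqP; apply: step => //.
    by rewrite edge_sym.
  by move/closed_connect => /(_ _ _ (conG a v)); rewrite !inE ca cv eqxx.
- move=> i cv; have vF : v \notin F by rewrite -cF cv.
  have nbr b : edge v b -> b \notin F -> c b = Some i.
    by move=> vb bF; rewrite -cv; apply/esym/c_edge.
  split.
    apply/subsetP => b; rewrite !inE cF; case: (boolP (b \in F)) => //= bF vb.
    by rewrite (nbr b).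
  apply: leq_trans (good_degree vF) _; apply: subset_leq_card; apply/subsetP => b.
  by rewrite !inE => /andP[bF vb]; rewrite vb (nbr b) //= eqxx.
Qed.

End Embedding.

(** * The extremal graphs *)

Section Targets.
Variable r : nat.

Definition colored (H : sgraph) (c : H -> option 'I_r) :=
  forall x y : H, edge x y = cj_edge c x y.

Definition osum (A B : Type) (f : A -> option 'I_r) (h : B -> option 'I_r) :
    A + B -> option 'I_r :=
  fun x => match x with inl a => f a | inr b => h b end.

Lemma card_sum_set (A B : finType) (P : pred (A + B)) :
  #|[set x | P x]| = #|[set a | P (inl a)]| + #|[set b | P (inr b)]|.
Proof. by rewrite -!sum1dep_card big_sumType. Qed.

Lemma colored_complete m z : colored (H := complete m) (fun=> z).
Proof. by move=> x y; rewrite /cj_edge eqxx !orbT andbT. Qed.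

Lemma colored_gunion (A B : sgraph) (f : A -> option 'I_r) (h : B -> option 'I_r) :
    colored f -> colored h ->
    (forall a b, [&& f a != None, h b != None & f a != h b]) ->
  colored (H := gunion A B) (osum f h).
Proof.
move=> colf colh fh [a|b] [a'|b'] /=; rewrite /cj_edge /=.
- by rewrite colf /cj_edge.
- by have /and3P[/negbTE -> /negbTE -> /negbTE ->] := fh a b'.
- by have /and3P[/negbTE -> /negbTE ->] := fh a' b; rewrite eq_sym => /negbTE ->.
- by rewrite colh /cj_edge.
Qed.

Lemma colored_gjoin m (B : sgraph) (h : B -> option 'I_r) : colored h ->
  colored (H := gjoin (complete m) B) (osum (fun=> None) h).
Proof.
by move=> colh [a|b] [a'|b'] /=; rewrite /cj_edge /= ?orbT ?andbT.
Qed.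

Lemma colored_copies m q (h : 'I_m -> 'I_r) : injective h ->
  colored (H := copies m (complete q)) (fun x => Some (h x.1)).
Proof.
move=> h_inj [i j] [i' j'] /=; rewrite /copies_edge /cj_edge /= /complete_edge.
rewrite xpair_eqE (inj_eq (@Some_inj _)) (inj_eq h_inj).
by case: (i == i') => //=; rewrite ?andbT ?andbF.
Qed.

(** The isolated vertex plays the part of [v] and inherits its colour, hence the term [(c v == z)]
    in the class sizes. *)
Lemma isomorphic_attach (V : finType) (c : V -> option 'I_r) v (W : {set V}) (H : sgraph)
    (N : pred H) (h : H -> option 'I_r) :
    colored h -> v \notin W ->
    (forall z, #|fiber c z| = (c v == z) + #|[set x | h x == z]|) ->
    (forall z, #|W :&: fiber c z| = #|[set x | N x && (h x == z)]|) ->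
  isomorphic (rewired c v W) (attach N).
Proof.
move=> colh vW card_c card_W.
pose c' : 'I_1 + H -> option 'I_r := osum (fun=> c v) h.
pose W' : {set 'I_1 + H} := [set x | if x is inr y then N y else false].
have v'W' : (inl ord0 : 'I_1 + H) \notin W' by rewrite inE.
apply: isomorphic_trans (_ : isomorphic _ (rewired c' (inl ord0) W')) _.
  apply: rewired_isomorphic => // z.
    rewrite -[LHS]/(#|fiber c z|) card_c card_sum_set /=; congr (_ + _).
    by case: (c v == z); rewrite ?cardsT ?card_ord // (_ : [set _ | _] = set0) ?cards0.
  transitivity #|W :&: fiber c z|; first by apply: eq_card => a; rewrite !inE.
  rewrite card_W card_sum_set [X in _ = X + _]eq_card0 /= => [|a]; last by rewrite !inE.
  by apply: eq_card => x; rewrite !inE.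
exists id; first by exists id.
move=> [i|x] [i'|x'] /=; rewrite /add_edge /rw_edge /= ?(ord1 i) ?(ord1 i') ?eqxx ?inE //=.
- by rewrite orbF.
- rewrite colh /cj_edge /= andbF orbF; case: (eqVneq x x') => [->|xx'] /=; first by rewrite eqxx.
  by rewrite (_ : inr x != inr x' :> 'I_1 + H) //; apply: contra_neq xx' => -[].
Qed.

Lemma card_ord_const m (b : bool) : #|[set i : 'I_m | b]| = b * m.
Proof.
case: b; first by rewrite mul1n cardsE; exact: card_ord.
by rewrite mul0n; apply: eq_card0 => i; rewrite inE.
Qed.

Lemma card_ord_ltn m d (b : bool) : d <= m -> #|[set i : 'I_m | (i < d) && b]| = b * d.
Proof.
move=> le_dm; case: b; last first.
  by rewrite mul0n; apply: eq_card0 => i; rewrite inE andbF.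
rewrite mul1n; under eq_finset => i do rewrite andbT.
by rewrite -sum1dep_card (big_ord_narrow le_dm) sum_nat_const card_ord muln1.
Qed.

Definition color_in (A : {set 'I_r}) (z : option 'I_r) : bool :=
  if z is Some l then l \in A else false.

Lemma card_copies m q (h : 'I_m -> 'I_r) (A : {set 'I_r}) (P : pred 'I_q) z :
    injective h -> (forall l, (l \in codom h) = (l \in A)) ->
  #|[set x : 'I_m * 'I_q | P x.2 && (Some (h x.1) == z)]| =
    color_in A z * #|[set j | P j]|.
Proof.
move=> h_inj hA; case: z => [l|] /=; last first.
  by rewrite mul0n; apply: eq_card0 => x; rewrite inE andbF.
rewrite -hA; case: (boolP (l \in codom h)) => [/codomP[i ->]|lh].
  rewrite mul1n -[RHS]mul1n -(cards1 i) -cardsX; apply: eq_card => -[i' j].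
  by rewrite !inE /= (inj_eq (@Some_inj _)) (inj_eq h_inj) andbC.
rewrite mul0n; apply: eq_card0 => -[i j]; rewrite inE /=.
by apply: contraNF lh => /andP[_ /eqP[<-]]; exact: codom_f.
Qed.

Lemma exists_enum (A : {set 'I_r}) m : #|A| = m ->
  exists2 h : 'I_m -> 'I_r, injective h & forall l, (l \in codom h) = (l \in A).
Proof.
move=> <-; exists enum_val; first exact: enum_val_inj.
move=> l; apply/codomP/idP => [[i ->]|lA]; first exact: enum_valP.
by exists (enum_rank_in lA l); rewrite enum_rankK_in.
Qed.

Lemma card_fibers (V : finType) (c : V -> option 'I_r) (U : {set V}) j q :
    (forall i, i != j -> #|U :&: fiber c (Some i)| = q) ->
  #|U| = #|U :&: fiber c None| + #|U :&: fiber c (Some j)| + (r - 1) * q.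
Proof.
move=> Uq.
transitivity (#|U :&: fiber c None| + \sum_i #|U :&: fiber c (Some i)|).
  rewrite -(cardsID (fiber c None)); congr (_ + _).
  rewrite -sum1_card (partition_big (fun a => odflt j (c a)) predT) //=.
  apply: eq_bigr => i _; rewrite -sum1_card; apply: eq_bigl => a; rewrite !inE.
  by case: (c a) => [l|] //=; rewrite ?andbF.
rewrite (bigD1 j) //= addnA; congr (_ + _).
rewrite (eq_bigr (fun=> q)) => [|i ij]; last exact: Uq.
rewrite sum_nat_const; congr (_ * _).
by rewrite cardC1 card_ord subn1.
Qed.

End Targets.

(** * Identification of the optimal configurations with the extremal graphs *)

Section Extremal.
Variables (V : finType) (r g k delta : nat) (R : realType).
Variables (c : V -> option 'I_r) (v : V) (W : {set V}).
Hypothesis opt : optimal g k delta R c v W.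
Hypotheses (k_gt0 : 0 < k) (d_gt0 : 0 < delta) (r_gt1 : 1 < r).

Lemma optimal_perron : exists2 x : V -> R, (forall a, 0 < x a)%R &
  forall a, (\sum_(b | rw_edge c v W a b) x b =
             spectral_radius R (rewired c v W) * x a)%R.
Proof.
apply: (@perron_vector R (rewired c v W)); first by apply/card_gt0P; exists v.
exact: admissible_connected opt.1.
Qed.

Definition core_color N m q (j : 'I_r) (h : 'I_m -> 'I_r) :
    'I_N + 'I_m * 'I_q -> option 'I_r :=
  osum (fun=> Some j) (fun x => Some (h x.1)).

Lemma colored_core N m q (j : 'I_r) (h : 'I_m -> 'I_r) (A : {set 'I_r}) :
    injective h -> (forall l, (l \in codom h) = (l \in A)) -> j \notin A ->
  colored (H := gunion (complete N) (copies m (complete q))) (core_color j h).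
Proof.
move=> h_inj hA jA; apply: colored_gunion; first exact: colored_complete.
  exact: colored_copies.
move=> _ [i _] /=; rewrite (inj_eq (@Some_inj _)).
by apply: contraNneq jA => ->; rewrite -hA codom_f.
Qed.

Lemma card_core N m q (j : 'I_r) (h : 'I_m -> 'I_r) (A : {set 'I_r}) z :
    injective h -> (forall l, (l \in codom h) = (l \in A)) ->
  #|[set x : 'I_N + 'I_m * 'I_q | core_color j h x == z]| =
    (Some j == z) * N + color_in A z * q.
Proof.
move=> h_inj hA; rewrite card_sum_set /= card_ord_const; congr (_ + _).
have := card_copies (q := q) xpredT z h_inj hA; rewrite card_ord_const mul1n => <-.
by apply: eq_card => x; rewrite !inE.
Qed.

Lemma card_setN1 (j : 'I_r) : #|[set~ j]| = r - 1.
Proof. by rewrite cardsC1 card_ord subn1. Qed.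

Lemma card_big_class j : (forall i, i != j -> #|fiber c (Some i)| = g.+1) ->
  #|fiber c (Some j)| = #|V| - (r - 1) * (g + 1) - k.
Proof.
move=> sizes; rewrite -[#|V|]cardsT (card_fibers (c := c) (U := [set: V]) (j := j) (q := g.+1)).
  by rewrite !finset.setTI (adm_cut opt.1) addn1 addnK addKn.
by move=> i ij; rewrite finset.setTI sizes.
Qed.

Lemma disjoint_card (A B : {set V}) : [disjoint A & B] -> #|A :&: B| = 0.
Proof. by move=> /disjoint_setI0 ->; rewrite cards0. Qed.

Lemma low_degree_cut : delta < g -> c v = None.
Proof.
move=> lt_dg; case cv: (c v) => [i|] //; have [_ gW] := adm_own opt.1 cv.
have := leq_trans gW (subset_leq_card (subsetIl _ _)).
by rewrite (adm_deg opt.1) leqNgt lt_dg.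
Qed.

Lemma isomorphic_delta_0 : delta < k -> delta < g ->
  isomorphic (rewired c v W) (G_delta_0 #|V| k delta g r).
Proof.
move=> lt_dk lt_dg; have cv := low_degree_cut lt_dg.
have [x x_gt0 xE] := optimal_perron.
have [j _ [sizes _ _ _ subs]] :=
  structure_cut opt x_gt0 xE r_gt1 (ltn_addl g lt_dk) cv.
have vD : v \in fiber c None by rewrite inE cv.
have subW : W \subset fiber c None.
  (* If [W] contains the [k - 1] other cut vertices, [delta < k] forces equality. *)
  case: subs => // subs.
  have cardD : #|fiber c None :\ v| = k.-1.
    by have := cardsD1 v (fiber c None); rewrite vD (adm_cut opt.1) => ->.
  have /eqP <- : fiber c None :\ v == W.
    by rewrite eqEcard subs (adm_deg opt.1) cardD -ltnS prednK.
  exact: subsetDl.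
have [h h_inj hA] := exists_enum (card_setN1 j).
pose N := #|V| - (r - 1) * (g + 1) - k.
have jA : j \notin [set~ j] by rewrite !inE eqxx.
have colH := colored_gjoin (m := k - 1) (colored_core (N := N) (q := g + 1) h_inj hA jA).
apply: (isomorphic_attach colH (adm_notin opt.1)) => z.
  rewrite card_sum_set /= card_ord_const (card_core _ _ _ _ h_inj hA) cv.
  case: z => [l|] /=; last by rewrite (adm_cut opt.1) mul1n !mul0n !addn0 subnKC.
  rewrite !inE (inj_eq (@Some_inj _)) [j == l]eq_sym.
  have [->|lj] := eqVneq l j; first by rewrite card_big_class // mul1n mul0n !add0n addn0.
  by rewrite sizes // mul0n !add0n mul1n addn1.
rewrite card_sum_set /= card_ord_ltn ?leq_subRL //.
rewrite [X in _ = _ + X](eq_card0 _) ?addn0 => [|y]; last by rewrite inE.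
case: z => [l|] /=; last by rewrite mul1n (setIidPl subW) (adm_deg opt.1).
rewrite mul0n; apply: disjoint_card; apply: disjointWl subW _.
by apply/pred0P => a; rewrite /= !inE; case: (c a).
Qed.

Lemma isomorphic_k1_deltak1 : 1 < k -> k <= delta -> delta < g ->
  isomorphic (rewired c v W) (G_k1_deltak1 #|V| k delta g r).
Proof.
move=> k_gt1 le_kd lt_dg; have cv := low_degree_cut lt_dg.
have [x x_gt0 xE] := optimal_perron.
have [j _ [sizes WC0 _ _ subs]] :=
  structure_cut opt x_gt0 xE r_gt1 (ltn_addr k lt_dg) cv.
have k_neq1 : k != 1 by rewrite gtn_eqF.
have vW := adm_notin opt.1.
have vD : v \in fiber c None by rewrite inE cv.
have cardD : #|fiber c None :\ v| = k - 1.
  by have := cardsD1 v (fiber c None); rewrite vD (adm_cut opt.1) => ->; rewrite addKn.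
have subW : fiber c None :\ v \subset W.
  (* [W] cannot lie in the cut, whose other vertices number [k - 1 < delta]. *)
  case: subs => // subs; have : W \subset fiber c None :\ v.
    apply/subsetP => a aW; rewrite in_setD1 (subsetP subs) // andbT.
    by apply: contraNneq vW => <-.
  by move=> /subset_leq_card; rewrite (adm_deg opt.1) cardD leqNgt subn1 prednK ?le_kd.
have WD : #|W :&: fiber c None| = k - 1.
  rewrite -cardD; apply: eq_card => a; rewrite !inE andbC.
  case: (boolP (c a == None)) => [ca|]; rewrite ?andbF //= andbT.
  apply/idP/idP => [aW|av]; first by apply: contraNneq vW => <-.
  by apply: (subsetP subW); rewrite !inE av ca.
have WC i : i != j -> #|W :&: fiber c (Some i)| = 0.
  by move=> ij; apply: disjoint_card; exact: WC0.
have Wj : #|W :&: fiber c (Some j)| = delta + 1 - k.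
  have := card_fibers WC; rewrite (adm_deg opt.1) WD muln0 addn0 => ->.
  by rewrite addnAC subnK ?addKn // ltnW.
have [h h_inj hA] := exists_enum (card_setN1 j).
pose N := #|V| - (r - 1) * (g + 1) - k.
have jA : j \notin [set~ j] by rewrite !inE eqxx.
have colH := colored_gjoin (m := k - 1) (colored_core (N := N) (q := g + 1) h_inj hA jA).
apply: (isomorphic_attach colH vW) => z.
  rewrite card_sum_set /= card_ord_const (card_core _ _ _ _ h_inj hA) cv.
  case: z => [l|] /=; last by rewrite (adm_cut opt.1) mul1n !mul0n !addn0 subnKC.
  rewrite !inE (inj_eq (@Some_inj _)) [j == l]eq_sym.
  have [->|lj] := eqVneq l j; first by rewrite card_big_class // mul1n mul0n !add0n addn0.
  by rewrite sizes // mul0n !add0n mul1n addn1.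
rewrite !card_sum_set /= card_ord_const card_ord_ltn; last first.
  by rewrite -Wj /N -(card_big_class sizes) subset_leq_card // subsetIr.
rewrite [X in _ = _ + (_ + X)](eq_card0 _) ?addn0 => [|y]; last by rewrite inE.
case: z => [l|] /=; last by rewrite WD mul1n mul0n addn0.
rewrite mul0n add0n (inj_eq (@Some_inj _)) eq_sym.
by have [->|lj] := eqVneq l j; rewrite ?Wj ?mul1n // WC.
Qed.

(** The cut is [{v}], so [v] is both the isolated vertex and the cut vertex. One edge goes to each
    small class, which leaves [delta - (r - 1)] for the remaining one. *)
Lemma isomorphic_0_delta : k = 1 -> delta < g ->
  isomorphic (rewired c v W) (G_0_delta #|V| delta g r).
Proof.
move=> k1 lt_dg; have cv := low_degree_cut lt_dg.
have [x x_gt0 xE] := optimal_perron.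
have [j _ [sizes _ WC1 WC _]] :=
  structure_cut opt x_gt0 xE r_gt1 (ltn_addr k lt_dg) cv.
have vW := adm_notin opt.1.
have D1 : fiber c None = [set v].
  have /eqP/cards1P[d Dd] := etrans (adm_cut opt.1) k1.
  have : v \in fiber c None by rewrite inE cv.
  by rewrite Dd inE => /eqP ->.
have WD : #|W :&: fiber c None| = 0.
  by apply: disjoint_card; rewrite D1 disjoint_sym disjoints1.
have W1 i : i != j -> #|W :&: fiber c (Some i)| = 1 by move=> ij; exact: WC1.
have Wj : #|W :&: fiber c (Some j)| = delta + 1 - r.
  have := card_fibers W1; rewrite (adm_deg opt.1) WD muln1 add0n => ->.
  by rewrite -addnA subnK ?addnK // ltnW.
have [h h_inj hA] := exists_enum (card_setN1 j).
pose N := #|V| - (r - 1) * (g + 1) - 1.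
have jA : j \notin [set~ j] by rewrite !inE eqxx.
have colH := colored_core (N := N) (q := g + 1) h_inj hA jA.
apply: (isomorphic_attach colH vW) => z.
  rewrite (card_core _ _ _ _ h_inj hA) cv.
  case: z => [l|] /=; last by rewrite (adm_cut opt.1) k1.
  rewrite !inE (inj_eq (@Some_inj _)) [j == l]eq_sym.
  have [->|lj] := eqVneq l j.
    by rewrite card_big_class // k1 mul1n mul0n !add0n addn0.
  by rewrite sizes // mul0n !add0n mul1n addn1.
rewrite !card_sum_set /= card_ord_ltn; last first.
  by rewrite -Wj /N -[X in _ - X]k1 -(card_big_class sizes) subset_leq_card // subsetIr.
have -> : #|[set b : 'I_(r - 1) * 'I_(g + 1) |
     (let (_, j0) := b in j0 == 0 :> nat) && (Some (h b.1) == z)]| = color_in [set~ j] z.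
  have := card_copies (q := g + 1) (fun j => j == 0 :> nat) z h_inj hA.
  have -> : #|[set j : 'I_(g + 1) | j == 0 :> nat]| = 1.
    have lt0 : 0 < g + 1 by rewrite addn1.
    by apply/eqP/cards1P; exists (Ordinal lt0); apply/setP => i; rewrite !inE.
  by rewrite muln1 => <-; apply: eq_card => -[a b]; rewrite !inE.
case: z => [l|] /=; last by rewrite WD.
rewrite !inE (inj_eq (@Some_inj _)) [j == l]eq_sym.
by have [->|lj] := eqVneq l j; rewrite ?Wj ?mul1n ?addn0 // W1.
Qed.

(** The class of [v] has [g + 1] vertices, [g] of them in [W]: without [v] it is the clique [K_g] to
    which the isolated vertex is fully joined. *)
Lemma isomorphic_deltag_g : g <= delta -> delta < g + k ->
  isomorphic (rewired c v W) (G_deltag_g #|V| k delta g r).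
Proof.
move=> le_gd lt_d; have [x x_gt0 xE] := optimal_perron.
case cv: (c v) => [i0|]; last first.
  by have := cut_vertex_not_optimal opt x_gt0 xE r_gt1 lt_d cv le_gd k_gt0.
have [j ji [size0 sizes subW Wi0]] := structure_own opt x_gt0 xE r_gt1 lt_d cv.
have vW := adm_notin opt.1.
have sizes' i : i != j -> #|fiber c (Some i)| = g.+1.
  by move=> ij; have [->|ii0] := eqVneq i i0; [exact: size0|exact: sizes].
have WC i : i != i0 -> #|W :&: fiber c (Some i)| = 0.
  move=> ii0; apply: disjoint_card; apply: disjointWl subW _.
  apply/pred0P => a; rewrite /= !inE; case: (c a) => [l|] //=.
  rewrite !(inj_eq (@Some_inj _)); apply/negP => /andP[/eqP -> /eqP i0i].
  by rewrite i0i eqxx in ii0.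
have WD : #|W :&: fiber c None| = delta - g.
  by have := card_fibers WC; rewrite (adm_deg opt.1) Wi0 muln0 addn0 => ->; rewrite addnK.
have cardA : #|~: [set i0; j]| = r - 2.
  by rewrite cardsCs finset.setCK cards2 card_ord eq_sym ji.
have [h h_inj hA] := exists_enum cardA.
pose N := #|V| - (r - 1) * (g + 1) - k.
have jA : j \notin ~: [set i0; j] by rewrite !inE eqxx orbT.
have colB : colored (H := gunion (gunion (complete N) (copies (r - 2) (complete (g + 1)))) (complete g))
    (osum (core_color j h) (fun=> Some i0)).
  apply: colored_gunion; [exact: colored_core hA jA|exact: colored_complete|].
  move=> [a|[i a]] b /=; rewrite (inj_eq (@Some_inj _)) //.
  have : h i \in ~: [set i0; j] by rewrite -hA codom_f.
  by rewrite !inE negb_or => /andP[].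
have colH := colored_gjoin (m := k) colB.
apply: (isomorphic_attach colH vW) => z.
  rewrite card_sum_set /= card_sum_set /= !card_ord_const (card_core _ _ _ _ h_inj hA) cv.
  case: z => [l|] /=; last by rewrite (adm_cut opt.1) mul1n !mul0n !addn0.
  rewrite !inE !(inj_eq (@Some_inj _)) [j == l]eq_sym [i0 == l]eq_sym mul0n add0n.
  have [->|li0] := eqVneq l i0.
    by rewrite (negbTE (_ : i0 != j)) 1?eq_sym // size0 mul1n !mul0n !add0n add1n.
  have [->|lj] := eqVneq l j.
    by rewrite card_big_class // mul1n !mul0n !add0n !addn0.
  by rewrite sizes // mul0n !add0n mul1n addn1 mul0n addn0.
rewrite !card_sum_set /= card_ord_ltn; last first.
  by rewrite leq_subLR ltnW.
have Z (T : finType) : #|[set _ : T | false]| = 0 by apply: eq_card0 => y; rewrite inE.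
rewrite !Z !add0n card_ord_const.
case: z => [l|] /=; last by rewrite WD mul1n mul0n !addn0.
rewrite !mul0n !add0n (inj_eq (@Some_inj _)) eq_sym.
by have [->|li] := eqVneq l i0; rewrite ?Wi0 ?mul1n // WC.
Qed.

End Extremal.

(** * Large minimum degree: joins of cliques without a rewired vertex *)

Section HighDegree.
Variables (V : finType) (r s k : nat) (R : realType).
Implicit Types c : V -> option 'I_r.

(** Used with [s = delta + 1 - k]: a vertex outside the cut has at most [k] neighbours in it, hence
    at least [delta - k] in its own class. *)
Definition balanced c : Prop :=
  #|fiber c None| = k /\ forall i, s <= #|fiber c (Some i)|.

Definition balanced_max c : Prop := balanced c /\ forall c', balanced c' ->
  (spectral_radius R (clique_join c') <= spectral_radius R (clique_join c))%R.

Lemma exists_balanced_max c : balanced c -> exists c', balanced_max c'.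
Proof.
move=> bal; pose P (t : {ffun V -> option 'I_r}) := `[< balanced t >].
have ffE c' : ([ffun a => c' a] : V -> option 'I_r) = c'.
  by apply: funext => a; rewrite ffunE.
have Pc : P [ffun a => c a] by apply/asboolP; rewrite ffE.
have [t /asboolP Pt t_max] := @Order.TotalTheory.arg_maxP _ R _ _ P
  (fun t : {ffun V -> option 'I_r} => spectral_radius R (clique_join t)) Pc.
exists t; split=> [|c' bal']; [exact: Pt|have := t_max [ffun a => c' a]; rewrite ffE].
by apply; apply/asboolP; rewrite ffE.
Qed.

Lemma balanced_recolor c y j l : balanced c -> c y = Some j -> j != l ->
  s < #|fiber c (Some j)| -> balanced (recolor c y l).
Proof.
move=> [cut cls] cy jl big_j; split.
  rewrite -cut; apply: eq_card => a; rewrite !inE /recolor.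
  by case: (eqVneq a y) => [->|//]; rewrite cy.
move=> i; have [->|ij] := eqVneq i j.
  rewrite (cardsD1 y) inE cy eqxx ltnS in big_j; apply: leq_trans big_j _.
  apply: subset_leq_card; apply/subsetP => a; rewrite !inE /recolor.
  by move=> /andP[/negbTE ->].
apply: leq_trans (cls i) _; apply: subset_leq_card; apply/subsetP => a.
rewrite !inE /recolor; case: (eqVneq a y) => [->|//].
by rewrite cy => /eqP[ji]; rewrite ji eqxx in ij.
Qed.

Lemma clique_join_connected c : 0 < #|fiber c None| -> connected_graph (clique_join c).
Proof.
move=> /card_gt0P[d]; rewrite inE => /eqP cd.
have csym := sym_connect_sym (@cj_edge_sym V r c).
have dP a : connect (cj_edge c) a d.
  have [->//|ad] := eqVneq a d; apply: connect1.
  by rewrite /cj_edge ad cd eqxx orbT.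
by move=> a b; apply: connect_trans (dP a) _; rewrite csym.
Qed.

(** Moving [y] to the heaviest class strictly increases the quadratic form at the Perron vector. By
    maximality the spectral radius could not grow, so [x] would be an eigenvector of the new graph
    with the old eigenvalue and the form would be unchanged. *)
Lemma balanced_max_sizes c : 0 < k -> 0 < r -> balanced_max c ->
  exists j, forall i, i != j -> #|fiber c (Some i)| = s.
Proof.
move=> k_gt0 r_gt0 [bal c_max]; have [cut cls] := bal.
have conc : connected_graph (clique_join c) by apply: clique_join_connected; rewrite cut.
have V_gt0 : 0 < #|clique_join c|.
  by have /card_gt0P[a _] : 0 < #|fiber c None| by [rewrite cut]; apply/card_gt0P; exists a.
have [x x_gt0 xE] := perron_vector R V_gt0 conc.
have [j _ jmax] := @Order.TotalTheory.arg_maxP _ R _ (Ordinal r_gt0) predT (cweight x c) isT.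
exists j => i ij; apply/eqP; rewrite eqn_leq cls andbT leqNgt; apply/negP => big_i.
have /card_gt0P[y] : 0 < #|fiber c (Some i)| by apply: leq_ltn_trans big_i.
rewrite inE => /eqP cy.
have le_rho := c_max _ (balanced_recolor bal cy ij big_i).
have cE l : (cweight x (recolor c y j) l =
    cweight x c l + ((l == j)%:R - (l == i)%:R) * x y)%R.
  by rewrite cweight_recolor cy (inj_eq (@Some_inj _)) [i == l]eq_sym.
have [_ spE] := spread_shift ij cE.
have quadE : quad (G := clique_join c) x =
    (spectral_radius R (clique_join c) * \sum_a x a ^+ 2)%R.
  rewrite mulr_sumr; apply: eq_bigr => a _.
  by rewrite -mulr_sumr (xE a) expr2 mulrCA.
have lt_quad : (quad (G := clique_join c) x < quad (G := clique_join (recolor c y j)) x)%R.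
  rewrite !quad_clique_join spE ltrD2l ltrDl.
  have := jmax i isT; have := x_gt0 y => xy le_ij.
  by rewrite mulr_gt0 ?mulr_gt0 // ltr_wpDl ?subr_ge0.
have [||le_rho' eigen] := @test_vector R (clique_join (recolor c y j)) x
    (spectral_radius R (clique_join c)).
- by exists y; rewrite gt_eqF.
- by rewrite -quadE ltW.
have {}eigen := eigen (le_anti (introT andP (conj le_rho le_rho'))).
move: lt_quad; rewrite quadE ltNge => /negP; apply.
rewrite mulr_sumr; apply: ler_sum => a _.
by rewrite -mulr_sumr eigen expr2 mulrCA.
Qed.

Lemma isomorphic_balanced c : 0 < k -> 0 < r -> balanced_max c ->
  isomorphic (clique_join c)
    (gjoin (complete k) (gunion (complete (#|V| - k - s * (r - 1)))
                                (copies (r - 1) (complete s)))).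
Proof.
move=> k_gt0 r_gt0 max_c; have [j sizes] := balanced_max_sizes k_gt0 r_gt0 max_c.
have [[cut cls] _] := max_c.
have sj : #|fiber c (Some j)| = #|V| - k - s * (r - 1).
  rewrite -[#|V|]cardsT (card_fibers (c := c) (U := [set: V]) (j := j) (q := s)).
    by rewrite !finset.setTI cut mulnC -addnA addKn addnK.
  by move=> i ij; rewrite finset.setTI sizes.
have [h h_inj hA] := exists_enum (card_setN1 j).
pose N := #|V| - k - s * (r - 1).
have jA : j \notin [set~ j] by rewrite !inE eqxx.
have colH := colored_gjoin (m := k) (colored_core (N := N) (q := s) h_inj hA jA).
apply: isomorphic_trans
  (_ : isomorphic _ (clique_join (osum (fun _ : 'I_k => None) (@core_color r N _ s j h)))) _.
  apply: clique_join_isomorphic => z.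
  rewrite card_sum_set /= card_ord_const (card_core _ _ _ _ h_inj hA).
  rewrite -[LHS]/(#|fiber c z|); case: z => [l|] /=; last by rewrite cut mul1n !mul0n !addn0.
  rewrite !inE (inj_eq (@Some_inj _)) [j == l]eq_sym.
  have [->|lj] := eqVneq l j; first by rewrite sj mul1n mul0n !add0n addn0.
  by rewrite sizes // mul0n !add0n mul1n.
by exists id; [exists id|move=> a b; rewrite colH].
Qed.

End HighDegree.

Theorem theorem1 (R : realType) (n k delta g r : nat) (G : sgraph) :
  2 <= r -> k + r * (g + 1) <= n -> graph_family n k delta g r G ->
  (delta < k -> delta < g ->
     spectral_bound R G (G_delta_0 n k delta g r)) /\
  (delta < k -> g <= delta ->
     spectral_bound R G (G_deltag_g n k delta g r)) /\
  (2 <= k -> k <= delta -> delta < g ->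
     spectral_bound R G (G_k1_deltak1 n k delta g r)) /\
  (k = 1 -> k <= delta -> delta < g ->
     spectral_bound R G (G_0_delta n delta g r)) /\
  (k <= delta -> g <= delta -> delta < g + k ->
     spectral_bound R G (G_deltag_g n k delta g r)) /\
  (g + k <= delta ->
     spectral_bound R G (G_join n k delta r)).
Proof.
move=> r_gt1 _ [conG <- [[v deg_v] deg_min] [[F [[_ F_comp F_good] cardF]] _]].
have r_gt0 : 0 < r := ltnW r_gt1.
have k_gt0 := cut_nonempty r_gt0 F_comp r_gt1 conG cardF.
have d_gt0 := min_degree_gt0 r_gt0 F_comp r_gt1 conG deg_v.
have [c [w [W [adm sub]]]] :=
  exists_admissible r_gt0 F_comp conG cardF F_good deg_v.
have G_gt0 : 0 < #|G| by apply/card_gt0P; exists v.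
have idG : bijective (@id G) by exists id.
have bound H : (forall c' w' W', @optimal G r g k delta R c' w' W' ->
    isomorphic (rewired c' w' W') H) -> spectral_bound R G H.
  move=> isoH; pose I := ((G -> option 'I_r) * G * {set G})%type.
  apply: (@spectral_bound_of_maximal R I
    (fun t => admissible g k delta t.1.1 t.1.2 t.2)
    (fun t => rewired t.1.1 t.1.2 t.2) G H (c, w, W) id) => //.
    have [c' [w' [W' [adm' max']]]] := exists_optimal R adm.
    by exists (c', w', W') => [|t]; [exact: adm'|apply: max'].
  move=> [[c' w'] W'] adm' max'; apply: isoH.
  split=> [|c2 w2 W2 adm2]; first exact: adm'.
  by have := max' (c2, w2, W2); apply.
split; first by move=> *; apply: bound => c' w' W' opt; apply: (isomorphic_delta_0 opt).
split.
  move=> lt_dk le_gd; apply: bound => c' w' W' opt.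
  by apply: (isomorphic_deltag_g opt) => //; exact: ltn_addl.
split; first by move=> *; apply: bound => c' w' W' opt; apply: (isomorphic_k1_deltak1 opt).
split; first by move=> *; apply: bound => c' w' W' opt; apply: (isomorphic_0_delta opt).
split; first by move=> *; apply: bound => c' w' W' opt; apply: (isomorphic_deltag_g opt).
move=> le_d; have [c0 [cF c_edge c_surj]] := cut_coloring r_gt0 F_comp.
have nbr (a : G) : a \notin F -> delta - k <= #|[set b | edge a b] :\: F|.
  move=> _; rewrite leq_subLR; apply: leq_trans (deg_min a) _.
  rewrite /deg -(cardsID F) leq_add2r -cardF.
  by apply: subset_leq_card; exact: subsetIr.
have s_le := cut_coloring_card cF c_edge c_surj nbr.
have bal : balanced (delta + 1 - k) k c0.
  split; first by rewrite -cardF; apply: eq_card => a; rewrite inE cF.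
  move=> i; rewrite addn1 subSn; first exact: s_le.
  exact: leq_trans (leq_addl g k) le_d.
apply: (@spectral_bound_of_maximal R _ (balanced (delta + 1 - k) k)
  (fun c => clique_join c) G _ c0 id) => //.
- move=> a b ab; rewrite /= /cj_edge; have -> /= : a != b.
    by apply: contraTneq ab => ->; rewrite edge_irr.
  rewrite !cF; case: (boolP (a \in F)) => //= aF; case: (boolP (b \in F)) => //= bF.
  by rewrite (c_edge a b).
- by have [c' [bal' max']] := exists_balanced_max R bal; exists c'.
- move=> c' bal' max'; rewrite /G_join.
  by apply: (@isomorphic_balanced _ _ _ _ R) => //; split.
Qed.
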